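(* Let $Y=\{y_1,\dots,y_n\}$, let $C\in\mathcal{D}_s(Y)$ be $Y$-substantial and connected, and let $a_{i,j}\in\mathbb{Q}$ for $1\le i\le j\le n$. Then $$\left\langle\exp\Bigl(\sum_{1\le i\le j\le n}a_{i,j}\;y_i\frown y_j\Bigr),\ \exp(C)\right\rangle=\exp\left(\sum_{p=1}^{\infty}\frac1{p!}\left\langle\exp\Bigl(\sum_{1\le i\le j\le n}a_{i,j}\;y_i\frown y_j\Bigr),\ C^p\right\rangle_{c}\right).$$
   Context: $\mathcal{D}(Y)$ is the algebra of formal power series, with coefficients in $\mathbb{Q}$, of (finite) uni-trivalent graphs whose univalent vertices are coloured by elements of $Y$ and whose trivalent vertices are oriented; the series are with respect to the grading by number of vertices. The commutative multiplication is disjoint union, with unit the empty graph; no relations are imposed. An element is connected if all its summands are (non-empty) connected graphs. A strut $y_i\frown y_j$ is a single edge with two univalent ends coloured $y_i$ and $y_j$; $D\in\mathcal{D}(Y)$ is $Y$-substantial if it contains no struts, and $\mathcal{D}_s(Y)$ is the subalgebra of such elements. The bilinear pairing $\langle D_1,D_2\rangle\in\mathcal{D}(\emptyset)$ is the sum of all ways of gluing all of the $y$-coloured vertices of $D_1$ to all of the $y$-coloured vertices of $D_2$, for every $y\in Y$ (glued univalent vertices disappear and their edges are joined); it is zero if the numbers of $y$-coloured vertices of $D_1$ and $D_2$ do not match for some $y$. $\langle D_1,D_2\rangle_c$ is the connected part of $\langle D_1,D_2\rangle$. $\exp$ is the exponential power series with respect to disjoint union. *)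

(* Defs.v *)
From HB Require Import structures.
From mathcomp Require Import all_boot all_order all_algebra.
From mathcomp Require Import boolp classical_sets functions cardinality fsbigop.

Set Implicit Arguments.
Unset Strict Implicit.
Unset Printing Implicit Defensive.

Import GRing.Theory.
Local Open Scope classical_set_scope.
Local Open Scope ring_scope.
Local Open Scope quotient_scope.

(* A uni-trivalent graph is encoded by its finite set H of half-edges:
   - [edg] is a fixed-point free involution whose orbits are the edges;
   - [vtx] satisfies vtx^3 = id and its orbits are the vertices: a fixed point
     is a univalent vertex, a 3-cycle is a trivalent vertex together with its
     orientation (a cyclic order of the three incident half-edges);
   - [col] is the colour of the univalent vertices, and is [None] exactly on
     the half-edges at trivalent vertices.
   Loops and multiple edges are allowed; H may be empty. *)
Definition predata (Y H : finType) : Type :=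
  ({ffun H -> H} * {ffun H -> H} * {ffun H -> option Y})%type.

Definition is_utgraph (Y H : finType) (d : predata Y H) : bool :=
  let: (v, e, c) := d in
  [forall h, [&& v (v (v h)) == h, e (e h) == h, e h != h
               & (c h == None) == (v h != h)]].

Record utgraph (Y H : finType) := UTGraph {
  utdata : predata Y H;
  _ : is_utgraph utdata }.

HB.instance Definition _ (Y H : finType) := [isSub for @utdata Y H].
HB.instance Definition _ (Y H : finType) := [Choice of utgraph Y H by <:].

Section Graphs.
Context {Y H : finType}.
Implicit Type G : utgraph Y H.

Definition vtx G : H -> H := (utdata G).1.1.
Definition edg G : H -> H := (utdata G).1.2.
Definition col G : H -> option Y := (utdata G).2.
Definition univalent G (h : H) : bool := vtx G h == h.

Lemma utgraphP G h :
  [/\ vtx G (vtx G (vtx G h)) = h, edg G (edg G h) = h, edg G h != h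
    & (col G h == None) = ~~ univalent G h].
Proof.
case: G => [[[v e] c] GP]; rewrite /univalent /vtx /edg /col /=.
by move/forallP: GP => /(_ h) /and4P[/eqP-> /eqP-> -> /eqP->].
Qed.

Lemma utgraph_subproof (v e : H -> H) (c : H -> option Y) :
  (forall h, [/\ v (v (v h)) = h, e (e h) = h, e h != h
               & (c h == None) = (v h != h)]) ->
  is_utgraph ([ffun h => v h], [ffun h => e h], [ffun h => c h]).
Proof.
move=> vec; apply/forallP => h; rewrite !ffunE.
by case: (vec h) => -> -> -> ->; rewrite !eqxx.
Qed.

Definition mkgraph v e c vec : utgraph Y H :=
  UTGraph (@utgraph_subproof v e c vec).

(* two half-edges are adjacent if they share a vertex or form an edge *)
Definition adj G : rel H :=
  [rel h k | [|| k == vtx G h, h == vtx G k | k == edg G h]].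

Definition connected_graph G : bool :=
  (0 < #|H|)%N && [forall h, forall k, connect (adj G) h k].

(* an edge with two univalent ends is a strut component *)
Definition has_strut G : bool :=
  [exists h, univalent G h && univalent G (edg G h)].

End Graphs.

Definition iso (Y H H' : finType) (G : utgraph Y H) (G' : utgraph Y H') : bool :=
  [exists f : {ffun H -> H'},
     [&& injectiveb f, #|H'| <= #|H|
       & [forall h, [&& f (vtx G h) == vtx G' (f h),
                        f (edg G h) == edg G' (f h)
                      & col G h == col G' (f h)]]]%N].

Lemma isoP (Y H H' : finType) (G : utgraph Y H) (G' : utgraph Y H') :
  reflect (exists f : H -> H',
      [/\ bijective f, {morph f : h / vtx G h >-> vtx G' h},
          {morph f : h / edg G h >-> edg G' h}
        & forall h, col G h = col G' (f h)])
    (iso G G').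
Proof.
apply: (iffP existsP) => [[f /and3P[/injectiveP f_inj cardH /forallP fP]]|].
  exists f; split=> [|h|h|h]; first exact: inj_card_bij.
  - by case/and3P: (fP h) => /eqP.
  - by case/and3P: (fP h) => _ /eqP.
  - by case/and3P: (fP h) => _ _ /eqP.
move=> [f [bij_f fv fe fc]]; exists (finfun f); apply/and3P; split.
- by apply/injectiveP=> x y; rewrite !ffunE; apply: bij_inj.
- by rewrite (bij_eq_card bij_f).
- by apply/forallP => h; rewrite !ffunE fv fe fc !eqxx.
Qed.

Lemma iso_refl (Y H : finType) (G : utgraph Y H) : iso G G.
Proof. by apply/isoP; exists id; split=> //; exists id. Qed.

Lemma iso_sym_imp (Y H H' : finType) (G : utgraph Y H) (G' : utgraph Y H') :
  iso G G' -> iso G' G.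
Proof.
move=> /isoP[f [[g fK gK] fv fe fc]]; apply/isoP; exists g; split.
- by exists f.
- by move=> h; apply: (can_inj fK); rewrite fv !gK.
- by move=> h; apply: (can_inj fK); rewrite fe !gK.
- by move=> h; rewrite fc gK.
Qed.

Lemma iso_trans (Y H1 H2 H3 : finType) (G1 : utgraph Y H1)
    (G2 : utgraph Y H2) (G3 : utgraph Y H3) :
  iso G1 G2 -> iso G2 G3 -> iso G1 G3.
Proof.
move=> /isoP[f [bf fv fe fc]] /isoP[g [bg gv ge gc]].
apply/isoP; exists (g \o f); split=> [|h|h|h] /=.
- exact: bij_comp.
- by rewrite fv gv.
- by rewrite fe ge.
- by rewrite fc gc.
Qed.

(* Isomorphism classes of graphs; every graph is isomorphic to one whose set
   of half-edges is some 'I_m. *)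
Definition lgraph (Y : finType) := {m : nat & utgraph Y 'I_m}.
HB.instance Definition _ (Y : finType) := Choice.on (lgraph Y).

Definition liso (Y : finType) : rel (lgraph Y) :=
  fun G G' => iso (tagged G) (tagged G').

Lemma liso_refl (Y : finType) : reflexive (@liso Y).
Proof. by move=> G; apply: iso_refl. Qed.

Lemma liso_sym (Y : finType) : symmetric (@liso Y).
Proof. by move=> G G'; apply/idP/idP; apply: iso_sym_imp. Qed.

Lemma liso_trans (Y : finType) : transitive (@liso Y).
Proof. by move=> G2 G1 G3; apply: iso_trans. Qed.

Canonical liso_equiv (Y : finType) :=
  EquivRel (@liso Y) (@liso_refl Y) (@liso_sym Y) (@liso_trans Y).

Definition gclass (Y : finType) := {eq_quot (@liso Y)}.
HB.instance Definition _ (Y : finType) := Choice.on (gclass Y).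
HB.instance Definition _ (Y : finType) := EqQuotient.on (gclass Y).

Section Classes.
Context {Y : finType}.

Lemma relabel_subproof (H : finType) (G : utgraph Y H) (i : 'I_#|H|) :
  let v i := enum_rank (vtx G (enum_val i)) in
  let e i := enum_rank (edg G (enum_val i)) in
  [/\ v (v (v i)) = i, e (e i) = i, e i != i
    & (col G (enum_val i) == None) = (v i != i)].
Proof.
case: (utgraphP G (enum_val i)) => v3 e2 e1 cE /=; rewrite !enum_rankK v3 e2 cE.
split; rewrite ?enum_valK //.
- by apply: contra e1 => /eqP {2}<-; rewrite enum_rankK.
- by rewrite /univalent (can2_eq (@enum_rankK H) (@enum_valK H)).
Qed.

Definition relabel (H : finType) (G : utgraph Y H) : lgraph Y :=
  Tagged (fun m => utgraph Y 'I_m) (mkgraph (relabel_subproof G)).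

Definition class_of (H : finType) (G : utgraph Y H) : gclass Y :=
  \pi_(gclass Y) (relabel G).

(* a representative of an isomorphism class, and its half-edges *)
Definition hedges (c : gclass Y) : finType := 'I_(tag (repr c)).
Definition graph_of (c : gclass Y) : utgraph Y (hedges c) := tagged (repr c).

Lemma iso_relabel (H : finType) (G : utgraph Y H) : iso G (tagged (relabel G)).
Proof.
apply/isoP; exists enum_rank; split=> [|h|h|h].
- exact: enum_rank_bij.
- by rewrite /vtx /= ffunE enum_rankK.
- by rewrite /edg /= ffunE enum_rankK.
- by rewrite /col /= ffunE enum_rankK.
Qed.

Lemma class_ofP (H H' : finType) (G : utgraph Y H) (G' : utgraph Y H') :
  reflect (class_of G = class_of G') (iso G G').
Proof.
suff -> : iso G G' = liso (relabel G) (relabel G').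
  by apply: (iffP idP) => /eqmodP.
apply/idP/idP => isoG; last first.
  apply: iso_trans (iso_relabel G) (iso_trans isoG _).
  exact/iso_sym_imp/iso_relabel.
exact: iso_trans (iso_sym_imp (iso_relabel G)) (iso_trans isoG (iso_relabel G')).
Qed.

Lemma graph_ofK (c : gclass Y) : class_of (graph_of c) = c.
Proof.
rewrite -[RHS]reprK; apply/eqmodP; apply: iso_sym_imp; exact: iso_relabel.
Qed.

End Classes.

Section Constructions.
Context {Y : finType}.

Lemma empty_subproof (h : void) :
  [/\ id (id (id h)) = h, id (id h) = h, id h != h
    & (@None Y == None) = (id h != h)].
Proof. by case: h. Qed.

Definition empty_graph : utgraph Y void := mkgraph empty_subproof.

(* the strut y -- y', with half-edges [true] and [false] *)
Lemma strut_subproof (y y' : Y) (h : bool) :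
  [/\ id (id (id h)) = h, negb (negb h) = h, negb h != h
    & ((if h then Some y else Some y') == None) = (id h != h)].
Proof. by case: h. Qed.

Definition strut_graph (y y' : Y) : utgraph Y bool :=
  mkgraph (strut_subproof y y').

Section Union.
Variables (H1 H2 : finType) (G1 : utgraph Y H1) (G2 : utgraph Y H2).

Definition sum_map (f1 : H1 -> H1) (f2 : H2 -> H2) (h : H1 + H2) : H1 + H2 :=
  match h with inl x => inl (f1 x) | inr x => inr (f2 x) end.

Definition sum_col (h : H1 + H2) : option Y :=
  match h with inl x => col G1 x | inr x => col G2 x end.

Lemma union_subproof (h : H1 + H2) :
  let v := sum_map (vtx G1) (vtx G2) in let e := sum_map (edg G1) (edg G2) in
  [/\ v (v (v h)) = h, e (e h) = h, e h != h
    & (sum_col h == None) = (v h != h)].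
Proof.
case: h => h /=; [case: (utgraphP G1 h) | case: (utgraphP G2 h)];
  by move=> -> -> e1 ->; split.
Qed.

Definition union_graph : utgraph Y (H1 + H2)%type := mkgraph union_subproof.

End Union.

(* Gluing the univalent vertices of G in pairs: [tau] is the involution of the
   half-edges that exchanges glued univalent vertices (which must have the same
   colour) and fixes the half-edges at trivalent vertices. *)
Section Glue.
Variables (H : finType) (G : utgraph Y H).
Implicit Type tau : {ffun H -> H}.

Definition is_matching tau : bool :=
  [forall h, [&& tau (tau h) == h, col G (tau h) == col G h
               & (tau h == h) == ~~ univalent G h]].

(* cross over the glued vertex at h, if there is one, then follow the edge *)
Definition walk tau (h : H) : H := edg G (tau h).

(* gluing creates no closed curve without vertices *)
Definition circle_free tau : bool :=
  [forall h, [exists k, fconnect (walk tau) h k && ~~ univalent G k]].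

(* the other end of the edge of the glued graph that starts at h: the first
   half-edge at a trivalent vertex met along the walk *)
Definition walk_end tau (h : H) : H :=
  let s := traject (walk tau) (walk tau h) #|H| in
  nth h s (find (fun k => ~~ univalent G k) s).

Lemma matchingP tau : is_matching tau -> forall h,
  [/\ tau (tau h) = h, col G (tau h) = col G h,
      univalent G (tau h) = univalent G h & (tau h == h) = ~~ univalent G h].
Proof.
move=> /forallP tauP h; case/and3P: (tauP h) => /eqP tauK /eqP tauc /eqP taue.
split=> //; apply: negb_inj.
by case: (utgraphP G (tau h)) (utgraphP G h) => _ _ _ <- [_ _ _ <-]; rewrite tauc.
Qed.

Lemma edgK : involutive (edg G).
Proof. by move=> h; case: (utgraphP G h). Qed.

Definition first_return tau m h :=
  [/\ (0 < m)%N, ~~ univalent G (iter m (walk tau) h)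
    & forall i, (0 < i < m)%N -> univalent G (iter i (walk tau) h)].

Lemma walk_inj tau : is_matching tau -> injective (walk tau).
Proof.
move=> tauP x y /(inv_inj edgK) /(congr1 tau).
by case: (matchingP tauP x) (matchingP tauP y) => -> _ _ _ [-> _ _ _].
Qed.

Lemma walk_endP tau h : is_matching tau -> ~~ univalent G h ->
  exists2 m, first_return tau m h & walk_end tau h = iter m (walk tau) h.
Proof.
move=> tauP hT; rewrite /walk_end.
set f := walk tau; set s := traject _ _ _.
have szs : size s = #|H| by rewrite size_traject.
have f_inj : injective f := walk_inj tauP.
have s_nth i : (i < #|H|)%N -> nth h s i = iter i.+1 f h.
  by move=> iH; rewrite /s (set_nth_default (walk tau h)) ?size_traject // nth_traject // iterSr.
have has_s : has (fun k => ~~ univalent G k) s.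
  apply/hasP; exists h => //; apply/trajectP; exists (order f h).-1.
    by rewrite prednK ?order_gt0 // /order max_card.
  by rewrite -iterSr prednK ?order_gt0 // iter_order.
have lt_find : (find (fun k => ~~ univalent G k) s < #|H|)%N.
  by rewrite -szs -has_find.
exists (find (fun k => ~~ univalent G k) s).+1; last exact: s_nth.
split=> //; first by rewrite -s_nth //; exact: (nth_find h has_s).
case=> // i /=; rewrite ltnS => ilt; have := before_find h ilt.
by rewrite (s_nth _ (ltn_trans ilt lt_find)) => /negbFE.
Qed.

Lemma walk_endE tau m h : is_matching tau -> ~~ univalent G h ->
  first_return tau m h -> walk_end tau h = iter m (walk tau) h.
Proof.
move=> tauP hT [m0 mT mU]; case: (walk_endP tauP hT) => n [n0 nT nU] ->.
case: (ltngtP m n) => [lt_mn|lt_nm|->//].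
- by have := nU m; rewrite m0 lt_mn (negPf mT) => /(_ isT).
- by have := mU n; rewrite n0 lt_nm (negPf nT) => /(_ isT).
Qed.

Lemma iter_walk_rev tau m h : is_matching tau ->
  iter m (walk tau) (tau (iter m (walk tau) h)) = tau h.
Proof.
move=> tauP; elim: m h => //= m IHm h.
rewrite -iterS iterSr /walk /=.
case: (matchingP tauP (edg G (tau (iter m (walk tau) h)))) => -> _ _ _.
by rewrite edgK; exact: IHm.
Qed.

Lemma walk_back tau m i h : is_matching tau ->
  ~~ univalent G (iter m (walk tau) h) -> (i <= m)%N ->
  iter i (walk tau) (iter m (walk tau) h) = tau (iter (m - i) (walk tau) h).
Proof.
move=> tauP mT le_im; rewrite -[RHS](iter_walk_rev i) //.
congr (iter i _ _); rewrite -iterD subnKC //; apply/esym/eqP.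
by case: (matchingP tauP (iter m (walk tau) h)) => _ _ _ ->.
Qed.

Lemma first_return_rev tau m h : is_matching tau -> ~~ univalent G h ->
  first_return tau m h ->
  first_return tau m (iter m (walk tau) h)
  /\ iter m (walk tau) (iter m (walk tau) h) = h.
Proof.
move=> tauP hT [m0 mT mU].
have backm : iter m (walk tau) (iter m (walk tau) h) = h.
  rewrite walk_back // subnn /=; apply/eqP.
  by case: (matchingP tauP h) => _ _ _ ->.
split=> //; split=> //; first by rewrite backm.
move=> i /andP[i0 im]; rewrite walk_back 1?ltnW //.
case: (matchingP tauP (iter (m - i) (walk tau) h)) => _ _ -> _.
by apply: mU; rewrite subn_gt0 im ltn_subrL i0 m0.
Qed.

Lemma walk_end_triv tau h : is_matching tau -> ~~ univalent G h ->
  ~~ univalent G (walk_end tau h).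
Proof. by move=> tauP hT; case: (walk_endP tauP hT) => m [_ mT _] ->. Qed.

Lemma walk_endK tau h : is_matching tau -> ~~ univalent G h ->
  walk_end tau (walk_end tau h) = h.
Proof.
move=> tauP hT; case: (walk_endP tauP hT) => m mP ->.
have [mP' mK] := first_return_rev tauP hT mP.
by rewrite (walk_endE tauP _ mP') //; case: mP.
Qed.

Lemma walk_end_neq tau h : is_matching tau -> ~~ univalent G h ->
  walk_end tau h != h.
Proof.
move=> tauP hT; case: (walk_endP tauP hT) => m [m0 mT mU] ->.
apply/eqP => mh.
pose w i := iter i (walk tau) h.
have back i : (i <= m)%N -> w i = tau (w (m - i)%N).
  by move=> le_im; rewrite /w -walk_back // mh.
have := odd_double_half m; case: (odd m); set j := m./2; rewrite -addnn.
- rewrite add1n => /esym mE; have := back j.+1; rewrite {}mE subSS addnK ltnS.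
  rewrite leq_addr => /(_ isT) /eqP; apply/negP.
  by case: (utgraphP G (tau (w j))).
- rewrite add0n => /esym mE; have := back j; rewrite {1 2}mE addnK leq_addr.
  move=> /(_ isT)/esym/eqP.
  case: (matchingP tauP (w j)) => _ _ _ -> /negP; apply; apply: mU.
  have j0 : (0 < j)%N by move: m0; rewrite mE; case: (j).
  by rewrite j0 mE -[ltnLHS]addn0 ltn_add2l.
Qed.

Definition triv_hedge : finType := {h : H | ~~ univalent G h}.

Lemma vtx_triv (h : triv_hedge) : ~~ univalent G (vtx G (val h)).
Proof.
apply: contra (valP h); rewrite /univalent => /eqP E.
by case: (utgraphP G (val h)) => v3 _ _ _; rewrite -{2}v3 !E.
Qed.

Section Glued.
Variables (tau : {ffun H -> H}) (tauP : is_matching tau).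

Definition glued_vtx (h : triv_hedge) : triv_hedge :=
  exist (fun k => ~~ univalent G k) _ (vtx_triv h).
Definition glued_edg (h : triv_hedge) : triv_hedge :=
  exist (fun k => ~~ univalent G k) _ (walk_end_triv tauP (valP h)).

Lemma glued_subproof (h : triv_hedge) :
  [/\ glued_vtx (glued_vtx (glued_vtx h)) = h, glued_edg (glued_edg h) = h,
      glued_edg h != h & (@None void == None) = (glued_vtx h != h)].
Proof.
split.
- by apply: val_inj => /=; case: (utgraphP G (val h)).
- by apply: val_inj => /=; rewrite walk_endK ?(valP h).
- by rewrite -val_eqE /= walk_end_neq ?(valP h).
- by rewrite -val_eqE /=; have := valP h; rewrite /univalent => ->.
Qed.

Definition glued_graph : utgraph void triv_hedge := mkgraph glued_subproof.

End Glued.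
End Glue.

(* The ways of gluing all univalent vertices of G1 to all those of G2,
   respecting colours. A gluing that creates a closed curve without vertices
   is not counted, since such a curve is not a uni-trivalent graph; this can
   only happen if both G1 and G2 have struts. *)
Section Pairing.
Variables (H1 H2 : finType) (G1 : utgraph Y H1) (G2 : utgraph Y H2).

Definition is_left (h : H1 + H2) : bool := if h is inl _ then true else false.

Definition is_gluing (tau : {ffun H1 + H2 -> H1 + H2}) : bool :=
  [&& is_matching (union_graph G1 G2) tau,
      circle_free (union_graph G1 G2) tau
    & [forall h, univalent (union_graph G1 G2) h
                 ==> (is_left (tau h) != is_left h)]].

Definition gluing : finType := {tau : {ffun H1 + H2 -> H1 + H2} | is_gluing tau}.

Lemma gluing_matching (t : gluing) : is_matching (union_graph G1 G2) (val t).
Proof. by case/and3P: (valP t). Qed.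

Definition glue (t : gluing) : gclass void :=
  class_of (glued_graph (gluing_matching t)).

End Pairing.
End Constructions.

(* Each degree contains finitely many isomorphism classes, so a formal power
   series of graphs is an arbitrary rational function on classes. The Z-module
   and Q-module structures are pointwise; the product is [dmul] below. *)
Definition dalg (Y : finType) : Type := gclass Y -> rat.
HB.instance Definition _ (Y : finType) :=
  GRing.Lmodule.copy (dalg Y) (gclass Y -> rat^o).

Section Series.
Context {Y : finType}.
Implicit Type D : dalg Y.

Definition basis (H : finType) (G : utgraph Y H) : dalg Y :=
  fun c => (c == class_of G)%:R.

Definition strut (y y' : Y) : dalg Y := basis (strut_graph y y').

Definition cunion (c1 c2 : gclass Y) : gclass Y :=
  class_of (union_graph (graph_of c1) (graph_of c2)).

Definition dmul D1 D2 : dalg Y := fun c =>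
  \sum_(p \in [set p : gclass Y * gclass Y | cunion p.1 p.2 = c])
    D1 p.1 * D2 p.2.

Definition dpow D (p : nat) : dalg Y :=
  iter p (dmul D) (basis (@empty_graph Y)).

(* sum of a series converging for the grading by number of vertices: each
   coefficient vanishes in all but finitely many terms *)
Definition dsum (F : nat -> dalg Y) : dalg Y := fun c =>
  \sum_(p \in [set: nat]) F p c.

Definition dexp D : dalg Y := dsum (fun p => (p`!%:R)^-1 *: dpow D p).

Definition connected_part D : dalg Y := fun c =>
  if connected_graph (graph_of c) then D c else 0.

Definition connected D : Prop :=
  forall c, D c != 0 -> connected_graph (graph_of c).

Definition substantial D : Prop :=
  forall c, D c != 0 -> ~~ has_strut (graph_of c).

(* the bilinear pairing, defined when each coefficient is a finite sum *)
Definition pairing D1 D2 : dalg void := fun c =>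
  \sum_(p \in [set: gclass Y * gclass Y])
    D1 p.1 * D2 p.2 *
    #|[set t : gluing (graph_of p.1) (graph_of p.2) | glue t == c]%SET|%:R.

End Series.

(* the connected part of the pairing *)
Definition cpairing (Y : finType) (D1 D2 : dalg Y) : dalg void :=
  connected_part (pairing D1 D2).

(* Main.v *)
(* Weight a graph G by hat D G = D(G) |Aut G|. Counting isomorphisms, products
   and pairings then become finite sums over decompositions of the labelled
   graph G: hat (D1 D2) G sums hat D1 S * hat D2 S' over the splittings of G into
   two unions of components, and, for D1 made of struts and D2 strutless,
   hat <D1, D2> G sums over the ways of cutting edges of G open and colouring
   the new ends. Call D grouplike if hat D takes disjoint unions to products. A
   connected C is primitive, so exp C is grouplike, and its connected part is C.
   Cuttings of a disjoint union are pairs of cuttings, so <exp(struts), exp C> is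
   grouplike too. Two grouplike series with the same connected part coincide. *)
From HB Require Import structures.
From mathcomp Require Import all_boot all_order all_algebra.
From mathcomp Require Import boolp classical_sets fsbigop.
From mathcomp Require Import ring.
Require Import Defs.

Set Implicit Arguments.
Unset Strict Implicit.
Unset Printing Implicit Defensive.

Import GRing.Theory Num.Theory.
Local Open Scope ring_scope.

(** The factor |Aut G| absorbs all symmetry factors: coefficients live on isomorphism classes, and
    if R represents the class of G, then |Aut G| is also the number of isomorphisms from R to G.
    Such an isomorphism can be dissected along R, whereas counting classes directly would need
    stabilisers at each step. Strutlessness of [C] enters because an edge of a glued graph then
    crosses at most one strut: the cut edges with their colours record the gluing up to isomorphism
    of the pieces, and no closed curve without vertices can arise. Multiplicativity replaces the
    usual count of how p copies of [C] are distributed among the components of a gluing;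
    connectedness of a gluing is never traced back to what was glued. What remains is a comparison
    on one nonempty connected graph, where the term p = 0 vanishes; hence the exponent starts at p =
    1. Infinite sums stay harmless since C^p vanishes on graphs with fewer than p half-edges, and
    cutting at most doubles the number of half-edges. *)

Lemma fsbig_point (I : finType) (T : choiceType) (A : set T) (u : I -> T)
    (F : I -> T -> rat) :
  (forall i, A (u i)) ->
  (forall i p, A p -> p <> u i -> F i p = 0) ->
  \sum_(p \in A) \sum_i F i p = \sum_i F i (u i).
Proof.
(* [A] may be infinite, but nonzero terms sit on the image of [u]; duplicates are removed because
   [u] need not be injective. *)
move=> Au F0; rewrite (@fsbigE _ _ _ _ _ (undup (codom u))) ?undup_uniq //.
- transitivity (\sum_(p <- undup (codom u)) \sum_i F i p).
    rewrite [RHS]big_seq_cond [LHS]big_seq_cond; apply: eq_bigl => p.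
    rewrite mem_undup; case: (boolP (p \in codom u)) => //= /codomP[i ->].
    by rewrite mem_set.
  rewrite exchange_big; apply: eq_bigr => i _.
  rewrite (bigD1_seq (u i)) ?undup_uniq ?mem_undup ?codom_f //=.
  rewrite big1_seq ?addr0 // => p /andP[pu]; rewrite mem_undup.
  by move=> /codomP[j pE]; apply: F0; [rewrite pE | apply/eqP].
- by move=> p /=; rewrite mem_undup => /codomP[i ->].
move=> p Ap; rewrite mem_undup => pN; rewrite big1 // => i _; apply: F0 => // pE.
by rewrite pE codom_f in pN.
Qed.

Lemma dsum_trunc (Y : finType) (F : nat -> dalg Y) (N : nat) c :
  (forall p, (N <= p)%N -> F p c = 0) -> dsum F c = \sum_(p < N) F p c.
Proof.
move=> F0; rewrite /dsum (fsbig_ord _ _ (fun p => F p c)).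
apply/esym/fsbig_widen => //= p [_ /negP]; rewrite -leqNgt.
exact: F0.
Qed.

(** * Isomorphisms and weights *)

Section Isomorphisms.
Context {Y : finType}.

(** The body copies the predicate under the quantifier in [iso], so that [iso] is nonemptiness of
    this set by mere unfolding. *)
Definition isos (H H' : finType) (G : utgraph Y H) (G' : utgraph Y H') :
    {set {ffun H -> H'}} :=
  [set f : {ffun H -> H'} | [&& injectiveb f, #|H'| <= #|H|
     & [forall h, [&& f (vtx G h) == vtx G' (f h),
                      f (edg G h) == edg G' (f h)
                    & col G h == col G' (f h)]]]%N].

Lemma isosP (H H' : finType) (G : utgraph Y H) (G' : utgraph Y H')
    (f : {ffun H -> H'}) :
  reflect [/\ injective f, forall h', exists h, f h = h',
              {morph f : h / vtx G h >-> vtx G' h},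
              {morph f : h / edg G h >-> edg G' h}
            & forall h, col G h = col G' (f h)]
    (f \in isos G G').
Proof.
rewrite inE; apply: (iffP and3P) => [[/injectiveP f_inj cardH /forallP fP]|].
  split=> [//|h'|h|h|h].
  - case: (inj_card_bij f_inj cardH) => g _ gK; exists (g h'); exact: gK.
  - by case/and3P: (fP h) => /eqP.
  - by case/and3P: (fP h) => _ /eqP.
  - by case/and3P: (fP h) => _ _ /eqP.
case=> f_inj f_surj fv fe fc; split.
- exact/injectiveP.
- apply: (@leq_trans #|codom f|); last by rewrite -(size_codom f) card_size.
  by apply/subset_leq_card/fintype.subsetP => h' _; case: (f_surj h') => h <-; exact: codom_f.
- by apply/forallP => h; rewrite fv fe -fc !eqxx.
Qed.

Lemma isosE (H H' : finType) (G : utgraph Y H) (G' : utgraph Y H') :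
  iso G G' = [exists f, f \in isos G G'].
Proof. by apply: eq_existsb => f; rewrite inE. Qed.

Lemma isoI (H H' : finType) (G : utgraph Y H) (G' : utgraph Y H') (f : H -> H') :
  injective f -> (forall h', exists h, f h = h') ->
  {morph f : h / vtx G h >-> vtx G' h} -> {morph f : h / edg G h >-> edg G' h} ->
  (forall h, col G h = col G' (f h)) -> iso G G'.
Proof.
move=> f_inj f_surj fv fe fc; rewrite isosE; apply/existsP; exists (finfun f).
apply/isosP; split=> [x y|h'|h|h|h]; rewrite ?ffunE //; first exact: f_inj.
by case: (f_surj h') => h; exists h; rewrite ffunE.
Qed.

Lemma iso_class_of (H H' : finType) (G : utgraph Y H) (G' : utgraph Y H') :
  (class_of G == class_of G') = iso G G'.
Proof. by apply/eqP/idP => /class_ofP. Qed.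

Lemma iso_graph_of (H : finType) (G : utgraph Y H) : iso (graph_of (class_of G)) G.
Proof. by rewrite -iso_class_of graph_ofK. Qed.

Lemma isos_comp (H1 H2 H3 : finType) (G1 : utgraph Y H1) (G2 : utgraph Y H2)
    (G3 : utgraph Y H3) (f : {ffun H1 -> H2}) (g : {ffun H2 -> H3}) :
  f \in isos G1 G2 -> g \in isos G2 G3 -> [ffun h => g (f h)] \in isos G1 G3.
Proof.
move=> /isosP[f_inj f_surj fv fe fc] /isosP[g_inj g_surj gv ge gc].
apply/isosP; split=> [x y|h3|h|h|h]; rewrite ?ffunE.
- by move/g_inj/f_inj.
- case: (g_surj h3) => h2 <-; case: (f_surj h2) => h1 <-.
  by exists h1; rewrite ffunE.
- by rewrite fv gv.
- by rewrite fe ge.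
- by rewrite fc gc.
Qed.

(** Precomposition with a fixed isomorphism is injective; applied in both directions it gives the
    equality [card_isosl]. *)
Lemma leq_card_isosl (H1 H2 H3 : finType) (G1 : utgraph Y H1)
    (G2 : utgraph Y H2) (G3 : utgraph Y H3) :
  iso G1 G2 -> (#|isos G2 G3| <= #|isos G1 G3|)%N.
Proof.
rewrite isosE => /existsP[f fP].
pose F (g : {ffun H2 -> H3}) := [ffun h => g (f h)] : {ffun H1 -> H3}.
have F_inj : injective F.
  move=> g g' /ffunP gg'; apply/ffunP => h2.
  by case/isosP: fP => _ /(_ h2)[h1 <-] _ _ _; move: (gg' h1); rewrite !ffunE.
rewrite -(card_imset _ F_inj) subset_leq_card //.
by apply/fintype.subsetP => _ /imsetP[g gP ->]; exact: isos_comp gP.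
Qed.

Lemma leq_card_isosr (H1 H2 H3 : finType) (G1 : utgraph Y H1)
    (G2 : utgraph Y H2) (G3 : utgraph Y H3) :
  iso G2 G3 -> (#|isos G1 G2| <= #|isos G1 G3|)%N.
Proof.
rewrite isosE => /existsP[f fP].
pose F (g : {ffun H1 -> H2}) := [ffun h => f (g h)] : {ffun H1 -> H3}.
have F_inj : injective F.
  move=> g g' /ffunP gg'; apply/ffunP => h1.
  by case/isosP: fP => f_inj _ _ _ _; move: (gg' h1); rewrite !ffunE => /f_inj.
rewrite -(card_imset _ F_inj) subset_leq_card //.
by apply/fintype.subsetP => _ /imsetP[g gP ->]; exact: isos_comp gP fP.
Qed.

Lemma card_isosl (H1 H2 H3 : finType) (G1 : utgraph Y H1)
    (G2 : utgraph Y H2) (G3 : utgraph Y H3) :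
  iso G1 G2 -> #|isos G1 G3| = #|isos G2 G3|.
Proof.
by move=> G12; apply/eqP; rewrite eqn_leq !leq_card_isosl //; exact: iso_sym_imp.
Qed.

Lemma card_isosr (H1 H2 H3 : finType) (G1 : utgraph Y H1)
    (G2 : utgraph Y H2) (G3 : utgraph Y H3) :
  iso G2 G3 -> #|isos G1 G2| = #|isos G1 G3|.
Proof.
by move=> G23; apply/eqP; rewrite eqn_leq !leq_card_isosr //; exact: iso_sym_imp.
Qed.

Lemma card_isos0 (H H' : finType) (G : utgraph Y H) (G' : utgraph Y H') :
  ~~ iso G G' -> #|isos G G'| = 0%N.
Proof.
rewrite isosE => /existsPn fN; apply/eqP; rewrite cards_eq0.
by apply/eqP/finset.setP => f; rewrite finset.in_set0; exact/negbTE/fN.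
Qed.

Lemma card_auts_gt0 (H : finType) (G : utgraph Y H) : (0 < #|isos G G|)%N.
Proof.
by have := iso_refl G; rewrite isosE => /existsP[f fP]; apply/card_gt0P; exists f.
Qed.

End Isomorphisms.

HB.lock Definition hat (Y : finType) (D : dalg Y) (H : finType)
    (G : utgraph Y H) : rat := D (class_of G) * #|isos G G|%:R.

Section Hat.
Context {Y : finType}.
Implicit Types D : dalg Y.

Lemma hatE D (H : finType) (G : utgraph Y H) :
  hat D G = D (class_of G) * #|isos G G|%:R.
Proof. by rewrite unlock. Qed.

Lemma hat_iso D (H H' : finType) (G : utgraph Y H) (G' : utgraph Y H') :
  iso G G' -> hat D G = hat D G'.
Proof.
move=> GG'; rewrite !hatE (eqP (_ : class_of G == class_of G')) ?iso_class_of //.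
by rewrite (card_isosl _ GG') (card_isosr _ GG').
Qed.

(** Together with [hat_class0], this turns a sum over classes weighted by isomorphism counts into a
    single value of [hat]. *)
Lemma hat_class D (H : finType) (G : utgraph Y H) (c : gclass Y) :
  c = class_of G -> D c * #|isos (graph_of c) G|%:R = hat D G.
Proof. by move=> ->; rewrite !hatE (card_isosl _ (iso_graph_of G)). Qed.

Lemma hat_class0 (H : finType) (G : utgraph Y H) (c : gclass Y) :
  c <> class_of G -> #|isos (graph_of c) G| = 0%N.
Proof.
by move=> /eqP cG; apply: card_isos0; rewrite -iso_class_of graph_ofK.
Qed.

Lemma hat_eq0 D (H : finType) (G : utgraph Y H) :
  (hat D G == 0) = (D (class_of G) == 0).
Proof. by rewrite hatE mulf_eq0 pnatr_eq0 (gtn_eqF (card_auts_gt0 G)) orbF. Qed.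

Lemma eq_hat D D' :
  (forall (H : finType) (G : utgraph Y H), hat D G = hat D' G) -> D = D'.
Proof.
move=> DD'; apply/funext => c; have := DD' _ (graph_of c); rewrite !hatE graph_ofK.
by apply: mulIf; rewrite pnatr_eq0 -lt0n card_auts_gt0.
Qed.

Lemma hatZ (a : rat) D (H : finType) (G : utgraph Y H) : hat (a *: D) G = a * hat D G.
Proof. by rewrite !hatE mulrA. Qed.

Lemma hat_dsum_trunc (F : nat -> dalg Y) (N : nat) (H : finType) (G : utgraph Y H) :
  (forall p, (N <= p)%N -> hat (F p) G = 0) ->
  hat (dsum F) G = \sum_(p < N) hat (F p) G.
Proof.
move=> F0; rewrite hatE (@dsum_trunc _ _ N) => [|p /F0/eqP].
  by rewrite mulr_suml; apply: eq_bigr => p _; rewrite hatE.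
by rewrite hat_eq0 => /eqP.
Qed.

End Hat.

(** * Splittings and products *)

Section MkGraph.
Context {Y H : finType} (v e : H -> H) (c : H -> option Y).
Context (vec : forall h, [/\ v (v (v h)) = h, e (e h) = h, e h != h
                           & (c h == None) = (v h != h)]).

Lemma vtx_mkgraph h : vtx (mkgraph vec) h = v h.
Proof. by rewrite /vtx ffunE. Qed.

Lemma edg_mkgraph h : edg (mkgraph vec) h = e h.
Proof. by rewrite /edg ffunE. Qed.

Lemma col_mkgraph h : col (mkgraph vec) h = c h.
Proof. by rewrite /col ffunE. Qed.

End MkGraph.

Section Splittings.
Context {Y H : finType} (G : utgraph Y H).

(** Invariance under [vtx] and [edg] makes each level set a union of components. The two parts are
    ordered and either may be empty, as for the factors of a product. *)
Definition is_splitting (phi : {ffun H -> bool}) : bool :=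
  [forall h, (phi (vtx G h) == phi h) && (phi (edg G h) == phi h)].

Definition splitting : finType := {phi : {ffun H -> bool} | is_splitting phi}.

Lemma splitting_vtx (phi : splitting) h : val phi (vtx G h) = val phi h.
Proof. by case/andP: (forallP (valP phi) h) => /eqP. Qed.

Lemma splitting_edg (phi : splitting) h : val phi (edg G h) = val phi h.
Proof. by case/andP: (forallP (valP phi) h) => _ /eqP. Qed.

Section Part.
Variables (phi : splitting) (b : bool).

Definition part_hedge : finType := {h : H | val phi h == b}.

Lemma part_vtx_subproof (h : part_hedge) : val phi (vtx G (val h)) == b.
Proof. by rewrite splitting_vtx (valP h). Qed.

Lemma part_edg_subproof (h : part_hedge) : val phi (edg G (val h)) == b.
Proof. by rewrite splitting_edg (valP h). Qed.

Definition part_vtx (h : part_hedge) : part_hedge :=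
  exist _ (vtx G (val h)) (part_vtx_subproof h).

Definition part_edg (h : part_hedge) : part_hedge :=
  exist _ (edg G (val h)) (part_edg_subproof h).

Lemma part_subproof (h : part_hedge) :
  [/\ part_vtx (part_vtx (part_vtx h)) = h, part_edg (part_edg h) = h,
      part_edg h != h & (col G (val h) == None) = (part_vtx h != h)].
Proof.
case: (utgraphP G (val h)) => v3 e2 e1 cE.
by split; [exact: val_inj | exact: val_inj | |].
Qed.

Definition part : utgraph Y part_hedge := mkgraph part_subproof.

Lemma val_vtx_part h : val (vtx part h) = vtx G (val h).
Proof. by rewrite vtx_mkgraph. Qed.

Lemma val_edg_part h : val (edg part h) = edg G (val h).
Proof. by rewrite edg_mkgraph. Qed.

Lemma col_part h : col part h = col G (val h).
Proof. by rewrite col_mkgraph. Qed.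

End Part.
End Splittings.

Section Union.
Context {Y H1 H2 : finType} (G1 : utgraph Y H1) (G2 : utgraph Y H2).

Lemma vtx_unionl h : vtx (union_graph G1 G2) (inl h) = inl (vtx G1 h).
Proof. by rewrite vtx_mkgraph. Qed.
Lemma vtx_unionr h : vtx (union_graph G1 G2) (inr h) = inr (vtx G2 h).
Proof. by rewrite vtx_mkgraph. Qed.
Lemma edg_unionl h : edg (union_graph G1 G2) (inl h) = inl (edg G1 h).
Proof. by rewrite edg_mkgraph. Qed.
Lemma edg_unionr h : edg (union_graph G1 G2) (inr h) = inr (edg G2 h).
Proof. by rewrite edg_mkgraph. Qed.
Lemma col_unionl h : col (union_graph G1 G2) (inl h) = col G1 h.
Proof. by rewrite col_mkgraph. Qed.
Lemma col_unionr h : col (union_graph G1 G2) (inr h) = col G2 h.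
Proof. by rewrite col_mkgraph. Qed.

Definition unionE :=
  (vtx_unionl, vtx_unionr, edg_unionl, edg_unionr, col_unionl, col_unionr).

End Union.

Section CardIsosUnion.
Context {Y H1 H2 H : finType}.
Variables (G1 : utgraph Y H1) (G2 : utgraph Y H2) (G : utgraph Y H).

Definition splits (f : {ffun H1 + H2 -> H}) (phi : splitting G) : bool :=
  [forall h, val phi (f h) == is_left h].

Lemma isos_splits (f : {ffun H1 + H2 -> H}) : f \in isos (union_graph G1 G2) G ->
  exists phi : splitting G, splits f =1 pred1 phi.
Proof.
case/isosP => f_inj f_surj fv fe fc.
pose phi := [ffun h => [exists x, f (inl x) == h]].
have phiE h : phi (f h) = is_left h.
  rewrite ffunE; case: h => h /=; first by apply/existsP; exists h.
  by apply/existsP => -[x /eqP/f_inj].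
have phiP : is_splitting G phi.
  apply/forallP => h; have [[x|x] <-] := f_surj h; rewrite -fv -fe !phiE;
  by rewrite unionE unionE.
exists (Sub phi phiP) => psi; apply/forallP/eqP => [psiP|-> h]; last first.
  by rewrite SubK phiE.
apply/val_inj/ffunP => h; have [x <-] := f_surj h.
by rewrite SubK phiE; exact/eqP.
Qed.

Section Fibre.
Variable phi : splitting G.

Definition join_isos
    (f : {ffun H1 -> part_hedge phi true} * {ffun H2 -> part_hedge phi false}) :
    {ffun H1 + H2 -> H} :=
  [ffun h : H1 + H2 => match h with
     inl x => val (f.1 x) | inr x => val (f.2 x) end].

Lemma join_isos_inj : injective join_isos.
Proof.
move=> [f1 f2] [g1 g2] /ffunP fg; congr (_, _); apply/ffunP => h; apply: val_inj.
  by move: (fg (inl h)); rewrite !ffunE.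
by move: (fg (inr h)); rewrite !ffunE.
Qed.

Lemma join_isosP :
  join_isos @: finset.setX (isos G1 (part phi true)) (isos G2 (part phi false)) =
  [set f in isos (union_graph G1 G2) G | splits f phi].
Proof.
apply/finset.setP => f; rewrite [RHS]finset.inE; apply/imsetP/andP.
  case=> -[f1 f2] /finset.setXP[/isosP[i1 s1 v1 e1 c1] /isosP[i2 s2 v2 e2 c2] ->].
  have LR x y : val (f1 x) <> val (f2 y).
    move=> xy; have := eqP (valP (f2 y)); rewrite -xy.
    by have := eqP (valP (f1 x)) => /= ->.
  split; [apply/isosP; split | apply/forallP].
  - move=> [x|x] [y|y]; rewrite !ffunE /= => E.
    + by congr inl; apply: i1; apply: val_inj; move: E.
    + by have := LR _ _ E.
    + by have := LR _ _ (esym E).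
    + by congr inr; apply: i2; apply: val_inj; move: E.
  - move=> h; case: (boolP (val phi h)) => [|/negbTE] /eqP ph.
      have [x xE] := s1 (Sub h ph); exists (inl x).
      by rewrite ffunE xE.
    have [x xE] := s2 (Sub h ph); exists (inr x).
    by rewrite ffunE xE.
  - case=> h; rewrite unionE !ffunE /=.
      by rewrite v1 val_vtx_part.
    by rewrite v2 val_vtx_part.
  - case=> h; rewrite unionE !ffunE /=.
      by rewrite e1 val_edg_part.
    by rewrite e2 val_edg_part.
  - case=> h; rewrite unionE ffunE /=.
      by rewrite c1 col_part.
    by rewrite c2 col_part.
  - by case=> h; rewrite ffunE; [exact: (valP (f1 h)) | exact: (valP (f2 h))].
case=> /isosP[f_inj f_surj fv fe fc] /forallP fphi.
pose f1 := [ffun x => Sub (f (inl x)) (fphi (inl x)) : part_hedge phi true].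
pose f2 := [ffun x => Sub (f (inr x)) (fphi (inr x)) : part_hedge phi false].
exists (f1, f2); last by apply/ffunP => -[x|x]; rewrite !ffunE.
apply/finset.setXP; split; apply/isosP; split.
- by move=> x y; rewrite !ffunE => /(congr1 val) /f_inj[].
- move=> h; have [[x|x] xE] := f_surj (val h).
    by exists x; apply: val_inj; rewrite ffunE.
  by move: (valP h) (fphi (inr x)); rewrite -xE => /eqP /= ->.
- by move=> h; apply: val_inj; rewrite val_vtx_part !ffunE /= -fv unionE.
- by move=> h; apply: val_inj; rewrite val_edg_part !ffunE /= -fe unionE.
- by move=> h; rewrite col_part !ffunE /= -fc unionE.
- by move=> x y; rewrite !ffunE => /(congr1 val) /f_inj[].
- move=> h; have [[x|x] xE] := f_surj (val h).
    by move: (valP h) (fphi (inl x)); rewrite -xE => /eqP /= ->.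
  by exists x; apply: val_inj; rewrite ffunE.
- by move=> h; apply: val_inj; rewrite val_vtx_part !ffunE /= -fv unionE.
- by move=> h; apply: val_inj; rewrite val_edg_part !ffunE /= -fe unionE.
- by move=> h; rewrite col_part !ffunE /= -fc unionE.
Qed.

End Fibre.

(** An isomorphism out of the disjoint union induces exactly one splitting of [G], by the images of
    the two summands; over a given splitting it amounts to a pair of isomorphisms, by
    [join_isosP]. *)
Lemma card_isos_union :
  #|isos (union_graph G1 G2) G| =
  (\sum_(phi : splitting G)
    #|isos G1 (part phi true)| * #|isos G2 (part phi false)|)%N.
Proof.
rewrite -sum1_card.
transitivity (\sum_(f in isos (union_graph G1 G2) G)
                \sum_(phi : splitting G) splits f phi)%N.
  apply: eq_bigr => f /isos_splits[phi phiP].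
  rewrite (bigD1 phi) //= phiP /= eqxx big1 // => psi /negbTE.
  by rewrite phiP /= => ->.
rewrite exchange_big; apply: eq_bigr => phi _.
rewrite -cardsX -(card_imset _ (@join_isos_inj phi)) join_isosP -[RHS]sum1_card.
rewrite big_mkcond [RHS]big_mkcond; apply: eq_bigr => f _.
by rewrite !finset.inE; case: [&& injectiveb f, _ & _]; case: (splits f phi).
Qed.

End CardIsosUnion.

Section HatProduct.
Context {Y : finType}.
Implicit Types D : dalg Y.

Lemma iso_unionP (H1 H2 H : finType) (G1 : utgraph Y H1) (G2 : utgraph Y H2)
    (G : utgraph Y H) :
  reflect (exists phi : splitting G, iso G1 (part phi true) /\ iso G2 (part phi false))
    (iso (union_graph G1 G2) G).
Proof.
apply: (iffP idP) => [|[phi [i1 i2]]].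
  rewrite isosE => /existsP[f fP]; have [phi phiP] := isos_splits fP.
  exists phi; have : f \in [set f in isos (union_graph G1 G2) G | splits f phi].
    by rewrite finset.inE fP phiP /= eqxx.
  rewrite -join_isosP => /imsetP[[f1 f2] /finset.setXP[p1 p2] _].
  by rewrite !isosE; split; apply/existsP; [exists f1 | exists f2].
move: i1 i2; rewrite !isosE => /existsP[f1 p1] /existsP[f2 p2].
apply/existsP; exists (join_isos (f1, f2)).
have : join_isos (f1, f2) \in [set f in isos (union_graph G1 G2) G | splits f phi].
  by rewrite -join_isosP; apply: imset_f; apply/finset.setXP.
by rewrite finset.inE => /andP[].
Qed.

Lemma iso_union (H1 H2 H1' H2' : finType) (G1 : utgraph Y H1) (G2 : utgraph Y H2)
    (G1' : utgraph Y H1') (G2' : utgraph Y H2') :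
  iso G1 G1' -> iso G2 G2' -> iso (union_graph G1 G2) (union_graph G1' G2').
Proof.
move=> /isoP[f [[f' fK f'K] fv fe fc]] /isoP[g [[g' gK g'K] gv ge gc]].
pose k (h : H1 + H2) : H1' + H2' := match h with inl x => inl (f x) | inr x => inr (g x) end.
apply: (isoI (f := k)).
- by move=> [x|x] [y|y] //= [] => [/(can_inj fK)|/(can_inj gK)] ->.
- by case=> h; [exists (inl (f' h)) | exists (inr (g' h))]; rewrite /= ?f'K ?g'K.
- by case=> h; rewrite !unionE /= ?fv ?gv.
- by case=> h; rewrite !unionE /= ?fe ?ge.
- by case=> h; rewrite !unionE /= ?fc ?gc.
Qed.

(** For classes whose union is the class of [G], |Aut G| is the number of isomorphisms from the
    union of their representatives to [G], which [card_isos_union] expands over splittings. Each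
    splitting then keeps only the pair of classes of its own two parts. *)
Theorem hat_dmul D1 D2 (H : finType) (G : utgraph Y H) :
  hat (dmul D1 D2) G =
  \sum_(phi : splitting G) hat D1 (part phi true) * hat D2 (part phi false).
Proof.
rewrite {1}hatE /dmul mulr_fsuml.
set A := mkset _; pose u (phi : splitting G) :=
  (class_of (part phi true), class_of (part phi false)).
have Au phi : A (u phi).
  rewrite /A /u /= /cunion; apply/class_ofP/iso_unionP; exists phi.
  by split; exact: iso_graph_of.
pose F (phi : splitting G) (p : gclass Y * gclass Y) :=
  (D1 p.1 * #|isos (graph_of p.1) (part phi true)|%:R) *
  (D2 p.2 * #|isos (graph_of p.2) (part phi false)|%:R).
transitivity (\sum_(p \in A) \sum_phi F phi p).
  apply: eq_fsbigr => p /set_mem Ap.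
  rewrite -(card_isosl _ (_ : iso (union_graph (graph_of p.1) (graph_of p.2)) G)).
    rewrite card_isos_union natr_sum mulr_sumr; apply: eq_bigr => phi _.
    by rewrite natrM /F; ring.
  exact/class_ofP.
rewrite (fsbig_point Au) => [|phi [c1 c2] _ pu].
  by apply: eq_bigr => phi _; rewrite /F !hat_class.
rewrite /F /=; have [E1|/hat_class0->] := pselect (c1 = class_of (part phi true)).
  have [E2|/hat_class0->] := pselect (c2 = class_of (part phi false)).
    by case: pu; rewrite E1 E2.
  by rewrite !mulr0.
by rewrite mulr0 mul0r.
Qed.

End HatProduct.

(** * Connectedness and grouplike series *)

Section Classification.
Context {Y : finType}.

Lemma iso_empty (H : finType) (G : utgraph Y H) :
  #|H| = 0%N -> iso G (@empty_graph Y).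
Proof.
move=> H0; have noH (h : H) : False by have := fintype0 h H0.
by apply: (isoI (f := fun h => match noH h with end)) => // h; case: (noH h).
Qed.

Lemma card_iso (H H' : finType) (G : utgraph Y H) (G' : utgraph Y H') :
  iso G G' -> #|H| = #|H'|.
Proof. by case/isoP => f [/bij_eq_card]. Qed.

Lemma hat_unit (H : finType) (G : utgraph Y H) :
  hat (basis (@empty_graph Y)) G = (#|H| == 0)%:R.
Proof.
rewrite !hatE /basis iso_class_of; have [H0|HN] := eqVneq #|H| 0%N; last first.
  case: (boolP (iso _ _)) => [/card_iso HE|_]; last by rewrite mul0r.
  by rewrite HE card_void in HN.
have E := iso_empty G H0; rewrite E mul1r (card_isosl _ E) (card_isosr _ E).
congr _%:R; apply/eqP; rewrite eqn_leq card_auts_gt0 andbT.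
by apply: leq_trans (max_card _) _; rewrite card_ffun card_void expn0.
Qed.

Lemma adj_sym (H : finType) (G : utgraph Y H) : symmetric (adj G).
Proof.
move=> h k; rewrite /adj /= orbCA; do 2 congr (_ || _).
by apply/eqP/eqP => ->; rewrite edgK.
Qed.

Lemma connected_iso_imp (H H' : finType) (G : utgraph Y H) (G' : utgraph Y H') :
  iso G G' -> connected_graph G -> connected_graph G'.
Proof.
move=> /[dup] /card_iso HH' /isoP[f [[g fK gK] fv fe fc]].
rewrite /connected_graph -HH' => /andP[-> /= /forallP Gc].
apply/forallP => h'; apply/forallP => k'.
rewrite -(gK h') -(gK k'); have /forallP/(_ (g k'))/connectP[s] := Gc (g h').
move=> sP ->; apply/connectP; exists (map f s); last by rewrite last_map.
rewrite path_map; apply: sub_path sP => x y /or3P[] /eqP ->; rewrite /adj /=.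
- by rewrite fv eqxx.
- by rewrite fv eqxx orbT.
- by rewrite fe eqxx !orbT.
Qed.

Lemma connected_iso (H H' : finType) (G : utgraph Y H) (G' : utgraph Y H') :
  iso G G' -> connected_graph G = connected_graph G'.
Proof.
by move=> GG'; apply/idP/idP; apply: connected_iso_imp; last exact: iso_sym_imp.
Qed.

Lemma connected_graph_of (H : finType) (G : utgraph Y H) :
  connected_graph (graph_of (class_of G)) = connected_graph G.
Proof. exact/connected_iso/iso_graph_of. Qed.

Lemma hat_disconnected (C : dalg Y) (H : finType) (G : utgraph Y H) :
  connected C -> ~~ connected_graph G -> hat C G = 0.
Proof.
move=> Cc; apply: contraNeq; rewrite !hatE mulf_eq0 negb_or -connected_graph_of.
by case/andP => /Cc.
Qed.

Section Splitting.
Context {H : finType} (G : utgraph Y H).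

Lemma const_splitting_subproof b : is_splitting G [ffun => b].
Proof. by apply/forallP => h; rewrite !ffunE eqxx. Qed.

Definition const_splitting b : splitting G := Sub _ (const_splitting_subproof b).

Lemma card_part (phi : splitting G) b :
  #|part_hedge phi b| = #|[pred h | val phi h == b]|.
Proof. exact: card_sig. Qed.

Lemma card_part_split (phi : splitting G) b :
  (#|part_hedge phi b| + #|part_hedge phi (~~ b)|)%N = #|H|.
Proof.
rewrite !card_part -(cardC [pred h | val phi h == b]); congr addn.
by apply: eq_card => h; rewrite !inE; case: (val phi h) b => [] [].
Qed.

Lemma card_part_eq0 (phi : splitting G) b :
  (#|part_hedge phi b| == 0) = (phi == const_splitting (~~ b)).
Proof.
rewrite card_part; apply/eqP/eqP => [/card0_eq P0|->].
  apply/val_inj/ffunP => h; rewrite SubK ffunE.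
  by have := P0 h; rewrite !inE; case: (val phi h); case: (b).
by apply/eq_card0 => h; rewrite !inE SubK ffunE; case: b.
Qed.

Lemma iso_part_const b : iso (part (const_splitting b) b) G.
Proof.
apply: (isoI (f := val)) => [|h|h|h|h].
- exact: val_inj.
- have hb : val (const_splitting b) h == b by rewrite SubK ffunE.
  by exists (Sub h hb); rewrite SubK.
- by rewrite val_vtx_part.
- by rewrite val_edg_part.
- by rewrite col_part.
Qed.

Lemma iso_part_union (phi : splitting G) :
  iso (union_graph (part phi true) (part phi false)) G.
Proof. by apply/iso_unionP; exists phi; split; exact: iso_refl. Qed.

Lemma connected_splitting (phi : splitting G) : connected_graph G ->
  (phi == const_splitting true) || (phi == const_splitting false).
Proof.
case/andP => /card_gt0P[h _] /forallP/(_ h)/forallP Gc.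
suff phiE k : val phi k = val phi h.
  apply/orP; case phih : (val phi h) phiE => phiE; [left | right];
  by apply/eqP/val_inj/ffunP => k; rewrite phiE SubK ffunE.
have /connectP[s sP ->] := Gc k; elim: s h sP {Gc} => //= x s IHs h.
case/andP => hx /IHs ->; case/or3P: hx => /eqP ->.
- exact: splitting_vtx.
- by rewrite splitting_vtx.
- exact: splitting_edg.
Qed.

(** One part is the component of some [h] from which some [k] cannot be reached. Both inequalities
    are strict, as the induction in [grouplike_ext] requires. *)
Lemma disconnected_splitting : (0 < #|H|)%N -> ~~ connected_graph G ->
  exists phi : splitting G, forall b, (#|part_hedge phi b| < #|H|)%N.
Proof.
move=> H0; rewrite /connected_graph H0 => /forallPn[h /forallPn[k hk]].
have symG : connect_sym (adj G) := sym_connect_sym (@adj_sym _ G).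
have phiP : is_splitting G [ffun x => connect (adj G) h x].
  apply/forallP => x; rewrite !ffunE.
  by apply/andP; split; apply/eqP/esym/(same_connect1r symG);
    rewrite /adj /= eqxx ?orbT.
exists (Sub _ phiP) => b; rewrite card_part; apply: (@leq_trans #|predT : pred H|); last by [].
(* A half-edge outside part [b]: [k] lies outside the component of [h], and [h] outside its
   complement. *)
have [x xP] : exists x, val (Sub _ phiP : splitting G) x != b.
  by case: b; [exists k | exists h]; rewrite SubK ffunE ?connect0 ?(negbTE hk).
apply: proper_card; apply/properP; split; first exact/fintype.subsetP.
by exists x.
Qed.

End Splitting.
End Classification.

Section SplittingUnion.
Context {Y H1 H2 : finType} (G1 : utgraph Y H1) (G2 : utgraph Y H2).

Definition union_splitting_fun (phi : splitting G1 * splitting G2) :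
    {ffun H1 + H2 -> bool} :=
  [ffun h => match h with inl x => val phi.1 x | inr x => val phi.2 x end].

Lemma union_splitting_subproof phi :
  is_splitting (union_graph G1 G2) (union_splitting_fun phi).
Proof.
apply/forallP => -[x|x]; rewrite !unionE !ffunE /=.
  by rewrite splitting_vtx splitting_edg eqxx.
by rewrite splitting_vtx splitting_edg eqxx.
Qed.

Definition union_splitting phi : splitting (union_graph G1 G2) :=
  Sub _ (union_splitting_subproof phi).

Lemma union_splitting_bij : bijective union_splitting.
Proof.
have lP (phi : splitting (union_graph G1 G2)) :
    is_splitting G1 [ffun x => val phi (inl x)].
  apply/forallP => x; rewrite !ffunE.
  by rewrite -(vtx_unionl _ G2) -(edg_unionl _ G2) splitting_vtx splitting_edg eqxx.
have rP (phi : splitting (union_graph G1 G2)) :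
    is_splitting G2 [ffun x => val phi (inr x)].
  apply/forallP => x; rewrite !ffunE.
  by rewrite -(vtx_unionr G1) -(edg_unionr G1) splitting_vtx splitting_edg eqxx.
exists (fun phi => (Sub _ (lP phi), Sub _ (rP phi))) => [[phi1 phi2]|phi].
  by congr (_, _); apply/val_inj/ffunP => x; rewrite SubK ffunE SubK ffunE.
by apply/val_inj/ffunP => -[x|x]; rewrite SubK ffunE SubK ffunE.
Qed.

Lemma sum_union_splitting (F : splitting (union_graph G1 G2) -> rat) :
  \sum_phi F phi = \sum_phi1 \sum_phi2 F (union_splitting (phi1, phi2)).
Proof.
rewrite pair_big (reindex union_splitting) /=; last first.
  exact: onW_bij union_splitting_bij.
by apply: eq_bigr => -[].
Qed.

Lemma iso_part_union_splitting phi1 phi2 b :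
  iso (union_graph (part phi1 b) (part phi2 b))
      (part (union_splitting (phi1, phi2)) b).
Proof.
have lP (x : part_hedge phi1 b) : val (union_splitting (phi1, phi2)) (inl (val x)) == b.
  by rewrite SubK ffunE (valP x).
have rP (x : part_hedge phi2 b) : val (union_splitting (phi1, phi2)) (inr (val x)) == b.
  by rewrite SubK ffunE (valP x).
pose f (h : part_hedge phi1 b + part_hedge phi2 b) :
    part_hedge (union_splitting (phi1, phi2)) b :=
  match h with inl x => exist _ (inl (val x)) (lP x) | inr x => exist _ (inr (val x)) (rP x) end.
apply: (isoI (f := f)).
- by move=> [x|x] [y|y] /(congr1 val) //= [/val_inj ->].
- move=> [[x|x] xP].
    have xP' : val phi1 x == b by move: (xP); rewrite SubK ffunE.
    by exists (inl (exist _ x xP')); apply: val_inj.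
  have xP' : val phi2 x == b by move: (xP); rewrite SubK ffunE.
  by exists (inr (exist _ x xP')); apply: val_inj.
- by case=> h; apply: val_inj; rewrite val_vtx_part !unionE /= val_vtx_part.
- by case=> h; apply: val_inj; rewrite val_edg_part !unionE /= val_edg_part.
- by case=> h; rewrite col_part !unionE col_part.
Qed.

End SplittingUnion.

(** * Grouplike series and the exponential of a connected series *)

Section Grouplike.
Context {Y : finType}.
Implicit Types C D : dalg Y.

Definition grouplike D : Prop :=
  hat D (@empty_graph Y) = 1 /\
  forall (H1 H2 : finType) (G1 : utgraph Y H1) (G2 : utgraph Y H2),
    hat D (union_graph G1 G2) = hat D G1 * hat D G2.

Lemma grouplike_ext D D' : grouplike D -> grouplike D' ->
  (forall c, connected_graph (graph_of c) -> D c = D' c) -> D = D'.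
Proof.
move=> [D1 DM] [D'1 D'M] DD'; apply: eq_hat => H G.
have [n] := ubnP #|H|; elim: n => // n IHn in H G *; rewrite ltnS => leHn.
have [H0|H0] := posnP #|H|.
  by rewrite !(hat_iso _ (iso_empty G H0)) D1 D'1.
have [Gc|GN] := boolP (connected_graph G).
  by rewrite !hatE DD' // connected_graph_of.
have [phi phiP] := disconnected_splitting H0 GN.
rewrite -!(hat_iso _ (iso_part_union phi)) DM D'M !IHn //.
  exact: leq_trans (phiP _) leHn.
exact: leq_trans (phiP _) leHn.
Qed.

Lemma hat_union_empty C (H1 H2 : finType) (G1 : utgraph Y H1) (G2 : utgraph Y H2) :
  #|H2| = 0%N -> hat C (union_graph G1 G2) = hat C G1.
Proof.
move=> H20; apply/esym/hat_iso/(isoI (f := inl)) => [x y []//|h'|h|h|h];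
  rewrite ?unionE //.
case: h' => h; [by exists h | by have := fintype0 h H20].
Qed.

Lemma hat_empty_union C (H1 H2 : finType) (G1 : utgraph Y H1) (G2 : utgraph Y H2) :
  #|H1| = 0%N -> hat C (union_graph G1 G2) = hat C G2.
Proof.
move=> H10; apply/esym/hat_iso/(isoI (f := inr)) => [x y []//|h'|h|h|h];
  rewrite ?unionE //.
case: h' => h; [by have := fintype0 h H10 | by exists h].
Qed.

(** Primitivity of [C], with evaluation on disjoint unions in the role of the coproduct; the two
    indicators are the values of the unit series. *)
Lemma hat_connected_union C (H1 H2 : finType) (G1 : utgraph Y H1)
    (G2 : utgraph Y H2) : connected C ->
  hat C (union_graph G1 G2) =
  (#|H2| == 0)%:R * hat C G1 + (#|H1| == 0)%:R * hat C G2.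
Proof.
move=> Cc.
have [H20|H2N] := eqVneq #|H2| 0; have [H10|H1N] := eqVneq #|H1| 0;
  rewrite ?(mul1r, mul0r, addr0, add0r).
(* With both summands empty the right side counts [C] twice; this is harmless, as connected graphs
   are nonempty and [C] vanishes here. *)
- rewrite !hat_disconnected ?addr0 // /connected_graph ?card_sum ?H10 ?H20 //.
- exact: hat_union_empty.
- exact: hat_empty_union.
apply: hat_disconnected => //; apply/negP => Uc.
have [h1 _] : exists h, h \in H1 by apply/card_gt0P; rewrite lt0n.
have [h2 _] : exists h, h \in H2 by apply/card_gt0P; rewrite lt0n.
pose phi : splitting (union_graph G1 G2) :=
  union_splitting (const_splitting G1 true, const_splitting G2 false).
by case/orP: (connected_splitting phi Uc) => /eqP/(congr1 val)/ffunP phiE;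
  [move: (phiE (inr h2)) | move: (phiE (inl h1))]; rewrite !ffunE.
Qed.

(** A Leibniz rule: by primitivity the part given to [C] lies within one summand, and the other
    summand passes undivided to [D]. *)
Lemma hat_dmul_union C D (H1 H2 : finType) (G1 : utgraph Y H1)
    (G2 : utgraph Y H2) : connected C ->
  hat (dmul C D) (union_graph G1 G2) =
    \sum_(phi : splitting G1)
      hat C (part phi true) * hat D (union_graph (part phi false) G2) +
    \sum_(phi : splitting G2)
      hat C (part phi true) * hat D (union_graph G1 (part phi false)).
Proof.
move=> Cc; rewrite hat_dmul sum_union_splitting.
have FE phi1 phi2 : hat C (part (union_splitting (phi1, phi2)) true) *
    hat D (part (union_splitting (phi1, phi2)) false) =
    (phi2 == const_splitting G2 false)%:R * (hat C (part phi1 true) *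
       hat D (union_graph (part phi1 false) (part phi2 false))) +
    (phi1 == const_splitting G1 false)%:R * (hat C (part phi2 true) *
       hat D (union_graph (part phi1 false) (part phi2 false))).
  rewrite -!(hat_iso _ (iso_part_union_splitting _ _ _)) hat_connected_union //.
  by rewrite !card_part_eq0 mulrDl !mulrA.
have sum_const (H : finType) (G : utgraph Y H) (F : splitting G -> rat) :
    \sum_phi (phi == const_splitting G false)%:R * F phi = F (const_splitting G false).
  rewrite (bigD1 (const_splitting G false)) //= eqxx mul1r big1 ?addr0 // => phi.
  by move/negbTE->; rewrite mul0r.
under eq_bigr do under eq_bigr do rewrite FE.
under eq_bigr do rewrite big_split /= sum_const.
rewrite big_split /=; congr (_ + _).
  apply: eq_bigr => phi _; congr (_ * _); apply/hat_iso/iso_union.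
    exact: iso_refl.
  exact: iso_part_const.
rewrite exchange_big; apply: eq_bigr => phi _ /=; rewrite sum_const.
by congr (_ * _); apply/hat_iso/iso_union; [exact: iso_part_const | exact: iso_refl].
Qed.

Definition expterm C p : dalg Y := (p`!%:R)^-1 *: dpow C p.

Lemma hat_expterm0 C (H : finType) (G : utgraph Y H) :
  hat (expterm C 0) G = (#|H| == 0)%:R.
Proof. by rewrite hatZ /= hat_unit fact0 invr1 mul1r. Qed.

Lemma hat_exptermS C p (H : finType) (G : utgraph Y H) :
  p.+1%:R * hat (expterm C p.+1) G =
  \sum_(phi : splitting G) hat C (part phi true) * hat (expterm C p) (part phi false).
Proof.
rewrite hatZ /= hat_dmul !mulr_sumr; apply: eq_bigr => phi _.
have p1 : p.+1%:R != 0 :> rat by rewrite pnatr_eq0.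
by rewrite hatZ factS natrM invfM !mulrA mulfV // mul1r [_^-1 * _]mulrC.
Qed.

Lemma hat_dmul_exptermE C p (H : finType) (G : utgraph Y H) :
  hat (dmul C (expterm C p)) G = p.+1%:R * hat (expterm C p.+1) G.
Proof. by rewrite hat_exptermS hat_dmul. Qed.

(** The coproduct of the divided power C^p/p!, obtained by induction from the Leibniz rule after
    multiplying by p+1 to clear the new denominator. *)
Lemma hat_expterm_union C p (H1 H2 : finType) (G1 : utgraph Y H1)
    (G2 : utgraph Y H2) : connected C ->
  hat (expterm C p) (union_graph G1 G2) =
  \sum_(q < p.+1) hat (expterm C q) G1 * hat (expterm C (p - q)) G2.
Proof.
move=> Cc; elim: p => [|p IHp] in H1 H2 G1 G2 *.
  by rewrite big_ord1 !hat_expterm0 card_sum addn_eq0 -natrM mulnb.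
have p1 : p.+1%:R != 0 :> rat by rewrite pnatr_eq0.
apply: (mulfI p1); rewrite -hat_dmul_exptermE hat_dmul_union //.
(* Write p+1 as q + (p+1-q): by [hat_exptermS] the weight q unfolds the factor on [G1] and the
   weight p+1-q the factor on [G2], matching the two Leibniz sums. *)
have -> : p.+1%:R * (\sum_(q < p.+2)
      hat (expterm C q) G1 * hat (expterm C (p.+1 - q)) G2) =
    \sum_(q < p.+2) (q%:R * hat (expterm C q) G1) * hat (expterm C (p.+1 - q)) G2 +
    \sum_(q < p.+2) hat (expterm C q) G1 *
      ((p.+1 - q)%:R * hat (expterm C (p.+1 - q)) G2).
  rewrite -big_split mulr_sumr; apply: eq_bigr => q _ /=.
  have qp : (q <= p.+1)%N by rewrite -ltnS ltn_ord.
  rewrite natrB //; move: (p.+1%:R) (q%:R) => r s.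
  by rewrite -mulrA [X in _ + X]mulrCA -mulrDl addrC subrK.
congr (_ + _).
  (* The term q = 0 has weight 0, and dropping it shifts the index; in the second sum the term q =
     p+1 drops instead. *)
  rewrite big_ord_recl !mul0r add0r.
  under eq_bigr do rewrite IHp mulr_sumr; rewrite exchange_big.
  apply: eq_bigr => q _ /=; rewrite hat_exptermS mulr_suml subSS.
  by apply: eq_bigr => phi _; rewrite mulrA.
rewrite big_ord_recr /= subnn mul0r mulr0 addr0.
under eq_bigr do rewrite IHp mulr_sumr; rewrite exchange_big.
apply: eq_bigr => q _ /=; have qp : (q <= p)%N by rewrite -ltnS ltn_ord.
rewrite subSn // hat_exptermS mulr_sumr.
by apply: eq_bigr => phi _; rewrite mulrCA.
Qed.

(** Each factor [C] must receive a nonempty part, so it uses up at least one half-edge. *)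
Lemma hat_expterm_eq0 C p (H : finType) (G : utgraph Y H) : connected C ->
  (#|H| < p)%N -> hat (expterm C p) G = 0.
Proof.
move=> Cc; elim: p => // p IHp in H G *; rewrite ltnS => leHp.
have p1 : p.+1%:R != 0 :> rat by rewrite pnatr_eq0.
apply: (mulfI p1); rewrite hat_exptermS mulr0 big1 // => phi _.
have [P0|P0] := posnP #|part_hedge phi true|.
  by rewrite hat_disconnected ?mul0r // /connected_graph P0.
rewrite IHp ?mulr0 //; apply: leq_trans leHp.
by rewrite -(card_part_split phi true) -[ltnLHS]add0n ltn_add2r.
Qed.

Lemma hat_dexp C N (H : finType) (G : utgraph Y H) : connected C ->
  (#|H| < N)%N -> hat (dexp C) G = \sum_(p < N) hat (expterm C p) G.
Proof.
move=> Cc HN; apply: hat_dsum_trunc => p Np.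
exact/hat_expterm_eq0/(leq_trans HN).
Qed.

Lemma dexp_grouplike C : connected C -> grouplike (dexp C).
Proof.
move=> Cc; split.
  by rewrite (@hat_dexp _ 1) ?card_void // big_ord1 hat_expterm0 card_void.
move=> H1 H2 G1 G2.
(* The terms of the exponential become coefficients of a polynomial, the truncation losing nothing.
   [hat_expterm_union] is then polynomial multiplication, and evaluation at 1 sums the series
   without reindexing a double sum. *)
pose P (H : finType) (G : utgraph Y H) := \poly_(p < #|H|.+1) hat (expterm C p) G.
have PE (H : finType) (G : utgraph Y H) : hat (dexp C) G = (P H G).[1].
  rewrite horner_poly (@hat_dexp _ #|H|.+1) //.
  by apply: eq_bigr => p _; rewrite expr1n mulr1.
have coefP (H : finType) (G : utgraph Y H) p : (P H G)`_p = hat (expterm C p) G.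
  by rewrite coef_poly; case: ltnP => // Hp; rewrite hat_expterm_eq0.
rewrite !PE -hornerM; congr _.[1]; apply/polyP => p.
rewrite coefM coefP hat_expterm_union //.
by apply: eq_bigr => q _; rewrite !coefP.
Qed.

Lemma dexp_connected C c : connected C -> connected_graph (graph_of c) ->
  dexp C c = C c.
Proof.
move=> Cc cc; set G := graph_of c.
have H0 : (0 < #|hedges c|)%N by case/andP: cc.
suff : hat (dexp C) G = hat C G.
  rewrite !hatE graph_ofK; apply: mulIf.
  by rewrite pnatr_eq0 -lt0n card_auts_gt0.
(* A connected graph has only the two trivial splittings. Giving nothing to [C] yields 0; giving
   everything to [C] leaves C^p/p! on the empty graph, which is nonzero only for p = 0. *)
have termS p : hat (expterm C p.+1) G = (p == 0)%:R * hat C G.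
  have p1 : p.+1%:R != 0 :> rat by rewrite pnatr_eq0.
  apply: (mulfI p1); rewrite hat_exptermS (bigD1 (const_splitting G true)) //=.
  have emptyT : #|part_hedge (const_splitting G true) false| = 0%N.
    by apply/eqP; rewrite card_part_eq0.
  rewrite (hat_iso _ (iso_part_const G true)) big1 ?addr0; last first.
    move=> phi phiN; have := connected_splitting phi cc.
    rewrite (negbTE phiN) -(card_part_eq0 phi true) => /eqP P0.
    by rewrite hat_disconnected ?mul0r // /connected_graph P0.
  case: p p1 => [|p] p1; first by rewrite hat_expterm0 emptyT mulr1 !mul1r.
  by rewrite hat_expterm_eq0 ?emptyT // !mul0r !mulr0.
rewrite (@hat_dexp _ #|hedges c|.+1) // big_ord_recl hat_expterm0.
rewrite (gtn_eqF H0) add0r; case: #|hedges c| H0 => // n _.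
rewrite big_ord_recl big1 ?addr0 => [|p _]; first by rewrite termS mul1r.
by rewrite termS mul0r.
Qed.

End Grouplike.

(** * Cuttings and the pairing *)

Section Cuttings.
Context {Y H : finType} (G : utgraph void H).

Lemma closed_trivalent h : ~~ univalent G h.
Proof. by case: (utgraphP G h) => _ _ _ <-; case: (col G h) => [[]|]. Qed.

(* A way of cutting some edges of [G] open: the half-edges of the cut edges are
   those with a colour, which the new univalent vertex inherits. *)
Definition is_cutting (s : {ffun H -> option Y}) : bool :=
  [forall h, (s (edg G h) == None) == (s h == None)].

Definition cutting : finType := {s : {ffun H -> option Y} | is_cutting s}.

Lemma cutting_edg (s : cutting) h : (val s (edg G h) == None) = (val s h == None).
Proof. exact: eqP (forallP (valP s) h). Qed.

Variable s : cutting.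

Definition cut_hedge : finType := {h : H | val s h != None}.

Lemma cut_edg_subproof (x : cut_hedge) : val s (edg G (val x)) != None.
Proof. by rewrite cutting_edg (valP x). Qed.

Definition cut_edg (x : cut_hedge) : cut_hedge :=
  exist _ (edg G (val x)) (cut_edg_subproof x).

Lemma cut_struts_subproof (x : cut_hedge) :
  [/\ id (id (id x)) = x, cut_edg (cut_edg x) = x, cut_edg x != x
    & (val s (val x) == None) = (id x != x)].
Proof.
case: (utgraphP G (val x)) => _ e2 e1 _; rewrite eqxx (negbTE (valP x)).
by split=> //; exact: val_inj.
Qed.

(* the struts that, glued to [cut_graph], restore [G] *)
Definition cut_struts : utgraph Y cut_hedge := mkgraph cut_struts_subproof.

Definition cut_graph_vtx (z : H + cut_hedge) : H + cut_hedge :=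
  match z with inl h => inl (vtx G h) | inr x => inr x end.

(** A cut half-edge is joined to a new univalent end of its own; [insub] decides whether [h] is cut.
    Thus every new end faces a trivalent vertex, and no strut appears. *)
Definition cut_graph_edg (z : H + cut_hedge) : H + cut_hedge :=
  match z with
  | inl h => if insub h is Some x then inr x else inl (edg G h)
  | inr x => inl (val x)
  end.

Definition cut_graph_col (z : H + cut_hedge) : option Y :=
  match z with inl _ => None | inr x => val s (val x) end.

Lemma cut_graph_subproof (z : H + cut_hedge) :
  [/\ cut_graph_vtx (cut_graph_vtx (cut_graph_vtx z)) = z,
      cut_graph_edg (cut_graph_edg z) = z, cut_graph_edg z != z
    & (cut_graph_col z == None) = (cut_graph_vtx z != z)].
Proof.
case: z => [h|x] /=; last by rewrite valK eqxx (negbTE (valP x)).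
case: (utgraphP G h) => v3 e2 e1 _; rewrite v3.
split=> //; last by have := closed_trivalent h.
  case: insubP => [x _ <- //|shN] /=.
  by rewrite insubN ?e2 // cutting_edg.
by case: insubP.
Qed.

Definition cut_graph : utgraph Y (H + cut_hedge)%type := mkgraph cut_graph_subproof.

Lemma vtx_struts x : vtx cut_struts x = x.
Proof. by rewrite vtx_mkgraph. Qed.

Lemma val_edg_struts x : val (edg cut_struts x) = edg G (val x).
Proof. by rewrite edg_mkgraph. Qed.

Lemma col_struts x : col cut_struts x = val s (val x).
Proof. by rewrite col_mkgraph. Qed.

Lemma vtx_cutl h : vtx cut_graph (inl h) = inl (vtx G h).
Proof. by rewrite vtx_mkgraph. Qed.

Lemma vtx_cutr x : vtx cut_graph (inr x) = inr x.
Proof. by rewrite vtx_mkgraph. Qed.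

Lemma edg_cutl h : val s h = None -> edg cut_graph (inl h) = inl (edg G h).
Proof. by rewrite edg_mkgraph /= => sh; rewrite insubN // sh. Qed.

Lemma edg_cutl_val x : edg cut_graph (inl (val x)) = inr x.
Proof. by rewrite edg_mkgraph /= valK. Qed.

Lemma edg_cutr x : edg cut_graph (inr x) = inl (val x).
Proof. by rewrite edg_mkgraph. Qed.

Lemma col_cutl h : col cut_graph (inl h) = None.
Proof. by rewrite col_mkgraph. Qed.

Lemma col_cutr x : col cut_graph (inr x) = val s (val x).
Proof. by rewrite col_mkgraph. Qed.

Variant edg_cutl_spec h : H + cut_hedge -> Prop :=
  | EdgCutlNone of val s h = None : edg_cutl_spec h (inl (edg G h))
  | EdgCutlSome x of val x = h : edg_cutl_spec h (inr x).

Lemma edg_cutlP h : edg_cutl_spec h (edg cut_graph (inl h)).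
Proof.
have [sh|sh] := eqVneq (val s h) None; first by rewrite edg_cutl //; constructor.
rewrite -[h](SubK (P := fun h => val s h != None) cut_hedge sh).
by rewrite edg_cutl_val; constructor.
Qed.

End Cuttings.

(** Double counting of related pairs. A relation spares writing two mutually inverse maps between
    sets of dependent data. *)
Lemma card_correspondence (A B : finType) (P : {set A}) (Q : {set B})
    (R : A -> B -> Prop) :
  (forall a, a \in P -> exists2 b, b \in Q & R a b) ->
  (forall b, b \in Q -> exists2 a, a \in P & R a b) ->
  (forall a b b', a \in P -> b \in Q -> b' \in Q -> R a b -> R a b' -> b = b') ->
  (forall a a' b, a \in P -> a' \in P -> b \in Q -> R a b -> R a' b -> a = a') ->
  #|P| = #|Q|.
Proof.
move=> PQ QP Rf Ri.
transitivity (\sum_(a in P) \sum_(b in Q) `[< R a b >])%N.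
  rewrite -sum1_card; apply: eq_bigr => a Pa; have [b Qb Rab] := PQ a Pa.
  rewrite (bigD1 b) //= (asboolT Rab) big1 // => b' /andP[Qb' bb'].
  by rewrite asboolF // => Rab'; case/eqP: bb'; exact: Rf Rab.
rewrite exchange_big -sum1_card; apply: eq_bigr => b Qb; have [a Pa Rab] := QP b Qb.
rewrite (bigD1 a) //= (asboolT Rab) big1 // => a' /andP[Pa' aa'].
by rewrite asboolF // => Ra'b; case/eqP: aa'; exact: Ri Rab.
Qed.

Lemma isos_univalent (Y H H' : finType) (G : utgraph Y H) (G' : utgraph Y H')
    (f : {ffun H -> H'}) h :
  f \in isos G G' -> univalent G' (f h) = univalent G h.
Proof. by case/isosP => f_inj _ fv _ _; rewrite /univalent -fv (inj_eq f_inj). Qed.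

(** * Gluing struts to a strutless graph *)

Section GluingStruts.
Context {Y H1 H2 : finType} (G1 : utgraph Y H1) (G2 : utgraph Y H2).
Hypothesis G1_struts : forall h, univalent G1 h.
Hypothesis G2_strutless : ~~ has_strut G2.
Local Notation U := (union_graph G1 G2).
Implicit Type tau : {ffun H1 + H2 -> H1 + H2}.

Lemma univalent_unionl h : univalent U (inl h).
Proof. by rewrite /univalent unionE (inj_eq (@inl_inj _ _)); exact: G1_struts. Qed.

Lemma univalent_unionr h : univalent U (inr h) = univalent G2 h.
Proof. by rewrite /univalent unionE (inj_eq (@inr_inj _ _)). Qed.

Lemma univalent_edg h : univalent G2 h -> ~~ univalent G2 (edg G2 h).
Proof. by move=> hU; move: G2_strutless => /existsPn/(_ h); rewrite hU. Qed.

Definition swaps tau : bool := [forall h, univalent U h ==> (is_left (tau h) != is_left h)].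

Lemma swapsl tau k : swaps tau -> exists l, tau (inl k) = inr l.
Proof.
move=> /forallP/(_ (inl k)); rewrite univalent_unionl /=.
by case: (tau _) => // l _; exists l.
Qed.

Lemma swapsr tau l : swaps tau -> univalent G2 l -> exists k, tau (inr l) = inl k.
Proof.
move=> /forallP/(_ (inr l)); rewrite univalent_unionr => /implyP tl /tl.
by case: (tau _) => // k _; exists k.
Qed.

Lemma matching_triv tau y : is_matching U tau -> ~~ univalent G2 y ->
  tau (inr y) = inr y.
Proof.
move=> tauP yT; case: (matchingP tauP (inr y)) => _ _ _.
by rewrite univalent_unionr yT => /eqP.
Qed.

Lemma matchingK tau : is_matching U tau -> involutive tau.
Proof. by move=> tauP z; case: (matchingP tauP z). Qed.

(** From any strut end one step of the walk crosses to a leg of [G2] and along its edge, whose far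
    end is trivalent as [G2] has no struts. A walk starting at a leg first traverses one strut. *)
Lemma struts_circle_free tau : is_matching U tau -> swaps tau -> circle_free U tau.
Proof.
move=> tauP tauS.
have right l : univalent G2 l -> ~~ univalent U (edg U (inr l)).
  by move=> lU; rewrite unionE univalent_unionr univalent_edg.
have left k : [exists z, fconnect (walk U tau) (inl k) z && ~~ univalent U z].
  have [l kl] := swapsl k tauS; apply/existsP; exists (walk U tau (inl k)).
  rewrite fconnect1 /walk kl right // -univalent_unionr -kl.
  by case: (matchingP tauP (inl k)) => _ _ -> _; rewrite univalent_unionl.
apply/forallP => -[k|y]; first exact: left.
have [yU|yT] := boolP (univalent G2 y); last first.
  by apply/existsP; exists (inr y); rewrite connect0 univalent_unionr.
have [k yk] := swapsr tauS yU.
have := left (edg G1 k) => /existsP[z /andP[kz zT]]; apply/existsP; exists z.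
rewrite zT andbT (connect_trans _ kz) //.
have -> : inl (edg G1 k) = walk U tau (inr y) by rewrite /walk yk unionE.
exact: fconnect1.
Qed.

Lemma walk_end_uncut tau y : is_matching U tau -> ~~ univalent G2 y ->
  ~~ univalent G2 (edg G2 y) -> walk_end U tau (inr y) = inr (edg G2 y).
Proof.
move=> tauP yT eyT.
have wE : iter 1 (walk U tau) (inr y) = inr (edg G2 y).
  by rewrite /= /walk matching_triv // unionE.
rewrite (@walk_endE _ _ _ _ 1) ?univalent_unionr //; split=> //.
  by rewrite wE univalent_unionr.
by case=> [|[]].
Qed.

(** The three steps of the walk are an edge of [G2], a strut, and a second edge of [G2];
    strutlessness makes the walk stop there. *)
Lemma walk_end_cut tau y k l' : is_matching U tau -> ~~ univalent G2 y ->
  univalent G2 (edg G2 y) -> tau (inr (edg G2 y)) = inl k ->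
  tau (inl (edg G1 k)) = inr l' ->
  walk_end U tau (inr y) = inr (edg G2 l').
Proof.
move=> tauP yT eyU yk kl'.
have w1 : walk U tau (inr y) = inr (edg G2 y).
  by rewrite /walk matching_triv // unionE.
have w2 : walk U tau (inr (edg G2 y)) = inl (edg G1 k) by rewrite /walk yk unionE.
have w3 : walk U tau (inl (edg G1 k)) = inr (edg G2 l') by rewrite /walk kl' unionE.
have l'U : univalent G2 l'.
  rewrite -univalent_unionr -kl'.
  by case: (matchingP tauP (inl (edg G1 k))) => _ _ -> _; rewrite univalent_unionl.
have wE : iter 3 (walk U tau) (inr y) = inr (edg G2 l') by rewrite /= w1 w2 w3.
rewrite (@walk_endE _ _ _ _ 3) ?univalent_unionr //; split=> //.
  by rewrite wE univalent_unionr univalent_edg.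
case=> [|[|[|i]]] // _; rewrite /= w1 ?univalent_unionr // w2.
exact: univalent_unionl.
Qed.

End GluingStruts.

(** * Gluings with a given result, counted by cuttings *)

Section GluingCuttings.
Context {Y H1 H2 H : finType}.
Variables (G1 : utgraph Y H1) (G2 : utgraph Y H2) (G : utgraph void H).
Hypothesis G1_struts : forall h, univalent G1 h.
Hypothesis G2_strutless : ~~ has_strut G2.
Local Notation U := (union_graph G1 G2).
Local Notation T := (triv_hedge U).

Definition glued_isos : {set gluing G1 G2 * {ffun T -> H}} :=
  [set a | a.2 \in isos (glued_graph (gluing_matching a.1)) G].

Lemma gluing_swaps (t : gluing G1 G2) : swaps G1 G2 (val t).
Proof. by case/and3P: (valP t). Qed.

Lemma gluingK (t : gluing G1 G2) : involutive (val t).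
Proof. exact: (matchingK (gluing_matching t)). Qed.

Lemma triv_right (x : T) : exists2 y, val x = inr y & ~~ univalent G2 y.
Proof.
have := valP x; case: (val x) => [k|y] /=; first by rewrite univalent_unionl.
by rewrite univalent_unionr; exists y.
Qed.

Lemma right_triv y : ~~ univalent G2 y -> exists x : T, val x = inr y.
Proof.
by move=> yT; have yT' : ~~ univalent U (inr y);
  [rewrite univalent_unionr | exists (Sub (inr y) yT')].
Qed.

Lemma triv_edg_cases (t : gluing G1 G2) (x : T) y : val x = inr y ->
  let w := val (glued_edg (gluing_matching t) x) in
  (~~ univalent G2 (edg G2 y) /\ w = inr (edg G2 y)) \/
  (exists k l, [/\ univalent G2 (edg G2 y), val t (inr (edg G2 y)) = inl k,
     val t (inl (edg G1 k)) = inr l, univalent G2 l & w = inr (edg G2 l)]).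
Proof.
move=> xy /=; have yT : ~~ univalent G2 y.
  by have := valP x; rewrite xy univalent_unionr.
rewrite xy; have tP := gluing_matching t; have tS := gluing_swaps t.
have [eyU|eyT] := boolP (univalent G2 (edg G2 y)); last first.
  by left; rewrite walk_end_uncut.
right; have [k yk] := swapsr tS eyU; have [l kl] := swapsl G1_struts (edg G1 k) tS.
exists k, l; split=> //; last exact: walk_end_cut kl.
rewrite -(univalent_unionr G1) -kl.
by case: (matchingP tP (inl (edg G1 k))) => _ _ -> _; rewrite univalent_unionl.
Qed.

(** The colour of the leg at the far end of the edge of [x] before gluing, hence [None] exactly when
    that edge meets no strut. *)
Definition cut_colour (x : T) : option Y := col U (edg U (val x)).

Definition cuts_along (s : cutting (Y := Y) G) (f : {ffun T -> H}) : bool :=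
  [forall x, val s (f x) == cut_colour x].

Lemma col_None (Z K : finType) (G' : utgraph Z K) h :
  ~~ univalent G' h -> col G' h = None.
Proof. by move=> hT; apply/eqP; case: (utgraphP G' h) => _ _ _ ->. Qed.

Lemma col_eqNone (Z K : finType) (G' : utgraph Z K) h :
  (col G' h == None) = ~~ univalent G' h.
Proof. by case: (utgraphP G' h). Qed.

(** Transporting [cut_colour] along the bijection leaves one candidate. It is a cutting because, by
    [triv_edg_cases], a glued edge through a strut has a leg behind both of its ends, and any other
    edge has none. *)
Lemma glued_isos_cutting a : a \in glued_isos ->
  exists s, (fun s => cuts_along s a.2) =1 pred1 s.
Proof.
case: a => t f; rewrite finset.inE => /isosP[f_inj f_surj fv fe fc] /=.
have /fin_all_exists[s sP] : forall h, exists v, exists2 x, f x = h & v = cut_colour x.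
  by move=> h; have [x <-] := f_surj h; exists (cut_colour x), x.
have sE x : finfun s (f x) = cut_colour x.
  by rewrite ffunE; case: (sP (f x)) => x' /f_inj ->.
have sC : is_cutting G (finfun s).
  apply/forallP => h; have [x <-] := f_surj h.
  rewrite -fe edg_mkgraph !sE /cut_colour; have [y xy yT] := triv_right x.
  case: (triv_edg_cases t xy) => [[eyT ->]|[k [l [eyU _ _ lU ->]]]].
    by rewrite xy !unionE edgK !col_None.
  by rewrite xy !unionE edgK !col_eqNone eyU lU.
exists (Sub _ sC) => s'; apply/forallP/eqP => [s'P|-> x]; last by rewrite SubK sE.
apply/val_inj/ffunP => h; have [x <-] := f_surj h.
by rewrite SubK sE; exact/eqP.
Qed.

Section Fibre.
Variable s : cutting (Y := Y) G.

Definition cut_isos :=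
  finset.setX (isos G1 (cut_struts s)) (isos G2 (cut_graph s)).

Definition fibre : {set gluing G1 G2 * {ffun T -> H}} :=
  [set a in glued_isos | cuts_along s a.2].

(** The second clause expresses that a strut end and the leg glued to it land on the same cut
    half-edge of [G]. *)
Definition corresponds (a : gluing G1 G2 * {ffun T -> H})
    (b : {ffun H1 -> cut_hedge s} * {ffun H2 -> H + cut_hedge s}) : Prop :=
  (forall x y, val x = inr y -> b.2 y = inl (a.2 x)) /\
  (forall k l, val a.1 (inl k) = inr l -> b.2 l = inr (b.1 k)).

Lemma cut_of_gluing a : a \in fibre -> exists2 b, b \in cut_isos & corresponds a b.
Proof.
case: a => t f; rewrite finset.inE => /andP[]; rewrite finset.inE /=.
case/isosP=> f_inj f_surj fv fe fc /forallP sP /=.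
pose tP := gluing_matching t; have tS := gluing_swaps t; have tK := gluingK t.
have cutE (x : T) y : val x = inr y -> univalent G2 (edg G2 y) -> val s (f x) != None.
  by move=> xy eyU; rewrite (eqP (sP x)) /cut_colour xy !unionE col_eqNone eyU.
have legE k : exists l, [/\ val t (inl k) = inr l, univalent G2 l
    & exists x : T, val x = inr (edg G2 l)].
  have [l kl] := swapsl G1_struts k tS; exists l.
  have lU : univalent G2 l.
    rewrite -(univalent_unionr G1) -kl.
    by case: (matchingP tP (inl k)) => _ _ -> _; rewrite univalent_unionl.
  by split=> //; apply/right_triv/univalent_edg.
(* The image of a strut end [k]: pass to the leg [l] glued to it, follow its edge to a trivalent
   half-edge [x], and apply [f]. *)
have /fin_all_exists[f1 f1P] : forall k, exists c : cut_hedge s, exists l (x : T),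
    [/\ val t (inl k) = inr l, val x = inr (edg G2 l) & val c = f x].
  move=> k; have [l [kl lU [x xl]]] := legE k.
  have xc : val s (f x) != None by apply: (cutE _ _ xl); rewrite edgK.
  by exists (Sub (f x) xc), l, x; rewrite SubK.
(* Trivalent half-edges follow [f]; a leg goes to the new end attached to the image of its trivalent
   neighbour. *)
have /fin_all_exists[f2 f2P] : forall y, exists v : H + cut_hedge s,
    match v with
    | inl h => exists2 x : T, val x = inr y & h = f x
    | inr c => univalent G2 y /\ exists2 x : T, val x = inr (edg G2 y) & val c = f x
    end.
  move=> y; have [yU|yT] := boolP (univalent G2 y); last first.
    by have [x xy] := right_triv yT; exists (inl (f x)), x.
  have [x xy] := right_triv (univalent_edg G2_strutless yU).
  have xc : val s (f x) != None by apply: (cutE _ _ xy); rewrite edgK.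
  by exists (inr (Sub (f x) xc)); split=> //; exists x.
have trivT (x : T) y : val x = inr y -> ~~ univalent G2 y.
  by move=> xy; have := valP x; rewrite xy univalent_unionr.
have f2T (x : T) y : val x = inr y -> f2 y = inl (f x).
  move=> xy; case: (f2 y) (f2P y) => [h [x' x'y ->]|c [yU _]].
    by congr (inl (f _)); apply: val_inj; rewrite xy.
  by have := trivT _ _ xy; rewrite yU.
have f2U (x : T) y : univalent G2 y -> val x = inr (edg G2 y) ->
    exists2 c, f2 y = inr c & val c = f x.
  move=> yU xy; case: (f2 y) (f2P y) => [h [x' /trivT]|c [_ [x' x'y cE]]].
    by rewrite yU.
  by exists c => //; rewrite cE; congr (f _); apply: val_inj; rewrite xy.
have f1E k l (x : T) : val t (inl k) = inr l -> val x = inr (edg G2 l) ->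
    val (f1 k) = f x.
  move=> kl xl; have [l' [x' [kl' x'l' ->]]] := f1P k; congr (f _).
  by apply: val_inj; rewrite xl x'l'; move: kl'; rewrite kl => -[->].
have walkE (x : T) y : val x = inr y -> univalent G2 (edg G2 y) -> exists k l,
    [/\ val t (inl k) = inr (edg G2 y), val t (inl (edg G1 k)) = inr l
      & val (glued_edg tP x) = inr (edg G2 l)].
  move=> xy eyU; case: (triv_edg_cases t xy) => [[]|]; first by rewrite eyU.
  by case=> k [l [_ yk kl _ wE]]; exists k, l; split=> //; rewrite -yk tK.
exists (finfun f1, finfun f2); last first.
  split=> /= [x y xy|k l kl]; first by rewrite ffunE; exact: f2T.
  have [l' [kl' lU [x xl]]] := legE k; rewrite !ffunE.
  have ll' : l' = l by move: kl'; rewrite kl => -[].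
  rewrite {}ll' in lU xl; have [c -> cE] := f2U _ _ lU xl; congr inr.
  by apply: val_inj; rewrite cE (f1E _ _ _ kl xl).
apply/finset.setXP; split; apply/isosP; split.
- move=> k k'; rewrite !ffunE => /(congr1 val).
  have [l [kl _ [x xl]]] := legE k; have [l' [kl' _ [x' xl']]] := legE k'.
  rewrite (f1E _ _ _ kl xl) (f1E _ _ _ kl' xl') => /f_inj xx'.
  have : val t (inl k) = val t (inl k').
    rewrite kl kl'; congr inr; apply: (inv_inj (edgK G2)).
    by move: xl; rewrite xx' xl' => -[].
  by move/(inv_inj tK) => -[].
- move=> c; have [x xc] := f_surj (val c); have [y xy yT] := triv_right x.
  have eyU : univalent G2 (edg G2 y).
    have := valP c; rewrite -xc (eqP (sP x)) /cut_colour xy !unionE col_eqNone.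
    by rewrite negbK.
  have [k [_ [kl _ _]]] := walkE _ _ xy eyU; exists k; apply: val_inj.
  by rewrite ffunE -xc; apply: (f1E _ _ _ kl); rewrite edgK.
- by move=> k; rewrite vtx_struts (eqP (G1_struts k)).
(* The walk from the trivalent half-edge behind one end of the strut emerges at the one behind its
   other end, and [f] respects glued edges. *)
- move=> k; apply: val_inj; rewrite val_edg_struts !ffunE.
  have [l [kl lU [x xl]]] := legE k; rewrite (f1E _ _ _ kl xl).
  have [k' [l' [kl' ekl' wE]]] : exists k l',
    [/\ val t (inl k) = inr l, val t (inl (edg G1 k)) = inr l'
      & val (glued_edg tP x) = inr (edg G2 l')].
    by have := walkE _ _ xl; rewrite !edgK => /(_ lU).
  have kk' : k' = k.
    by have /(inv_inj tK)[] : val t (inl k') = val t (inl k) by rewrite kl.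
  rewrite kk' in ekl'; rewrite -fe edg_mkgraph; exact: (f1E _ _ _ ekl' wE).
- move=> k; have [l [kl lU [x xl]]] := legE k.
  rewrite col_struts ffunE (f1E _ _ _ kl xl) (eqP (sP x)) /cut_colour xl unionE.
  rewrite edgK -kl; case: (matchingP tP (inl k)) => _ -> _ _.
  by rewrite unionE.
- move=> y y'; rewrite !ffunE.
  case: (f2 y) (f2P y) => [h [x xy ->]|c [_ [x xy cE]]];
  case: (f2 y') (f2P y') => [h' [x' xy' ->]|c' [_ [x' xy' cE']]] //.
    by move=> [/f_inj xx']; move: xy; rewrite xx' xy' => -[].
  case=> cc'; move: cE; rewrite cc' cE' => /f_inj xx'.
  by move: xy; rewrite -xx' xy' => -[/(inv_inj (edgK G2))].
- case=> [h|c].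
    have [x <-] := f_surj h; have [y xy yT] := triv_right x; exists y.
    by rewrite ffunE (f2T _ _ xy).
  have [x xc] := f_surj (val c); have [y xy yT] := triv_right x.
  have eyU : univalent G2 (edg G2 y).
    have := valP c; rewrite -xc (eqP (sP x)) /cut_colour xy !unionE col_eqNone.
    by rewrite negbK.
  exists (edg G2 y); rewrite ffunE.
  have [|c' -> c'E] := f2U x _ eyU; first by rewrite edgK.
  by congr inr; apply: val_inj; rewrite c'E.
- move=> y; rewrite !ffunE; have [yU|yT] := boolP (univalent G2 y).
    have [x xy] := right_triv (univalent_edg G2_strutless yU).
    by have [c cE _] := f2U _ _ yU xy; rewrite (eqP yU) cE vtx_cutr.
  have [x xy] := right_triv yT; rewrite (f2T _ _ xy) vtx_cutl -fv.
  by apply: f2T; rewrite vtx_mkgraph /= xy unionE.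
- move=> y; rewrite !ffunE; have [yU|yT] := boolP (univalent G2 y).
    have [x xy] := right_triv (univalent_edg G2_strutless yU).
    by have [c -> cE] := f2U _ _ yU xy; rewrite (f2T _ _ xy) edg_cutr cE.
  have [x xy] := right_triv yT; rewrite (f2T _ _ xy).
  have [eyU|eyT] := boolP (univalent G2 (edg G2 y)).
    have [|c -> <-] := f2U x _ eyU; first by rewrite edgK.
    by rewrite edg_cutl_val.
  rewrite edg_cutl; last by rewrite (eqP (sP x)) /cut_colour xy !unionE col_None.
  rewrite -fe edg_mkgraph; apply: f2T.
  by case: (triv_edg_cases t xy) => [[]|[k [l []]]] //; rewrite (negbTE eyT).
- move=> y; rewrite !ffunE; have [yU|yT] := boolP (univalent G2 y).
    have [x xy] := right_triv (univalent_edg G2_strutless yU).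
    have [c -> cE] := f2U _ _ yU xy; rewrite col_cutr cE (eqP (sP x)).
    by rewrite /cut_colour xy !unionE edgK.
  by have [x xy] := right_triv yT; rewrite (f2T _ _ xy) col_cutl col_None.
Qed.

Lemma corresponds_fun a b b' : b \in cut_isos -> b' \in cut_isos ->
  corresponds a b -> corresponds a b' -> b = b'.
Proof.
case: a b b' => t f [f1 f2] [f1' f2'].
case/finset.setXP => p1 p2 /finset.setXP[p1' p2'] [/= T1 U1] [/= T1' U1'].
(* The first clause fixes the values at trivalent half-edges; a leg is reached from its trivalent
   neighbour because both maps commute with [edg]. *)
have f2E y : f2 y = f2' y.
  have [yU|yT] := boolP (univalent G2 y); last first.
    by have [x xy] := right_triv yT; rewrite (T1 _ _ xy) (T1' _ _ xy).
  have [x xy] := right_triv (univalent_edg G2_strutless yU).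
  case/isosP: p2 p2' => _ _ _ fe _ /isosP[_ _ _ fe' _].
  by rewrite -[y](edgK G2) fe fe' (T1 _ _ xy) (T1' _ _ xy).
congr (_, _); apply/ffunP; last exact: f2E.
move=> k.
have [l kl] := swapsl G1_struts k (gluing_swaps t).
by have := f2E l; rewrite (U1 _ _ kl) (U1' _ _ kl) => -[].
Qed.

Lemma corresponds_inj a a' b : b \in cut_isos ->
  corresponds a b -> corresponds a' b -> a = a'.
Proof.
case: a a' b => t f [t' f'] [f1 f2].
case/finset.setXP => p1 p2 [/= T1 U1] [/= T1' U1'].
case/isosP: p1 p2 => f1_inj _ _ _ _ /isosP[f2_inj _ _ _ _].
congr (_, _); last first.
  apply/ffunP => x; have [y xy _] := triv_right x.
  by have := T1 _ _ xy; rewrite (T1' _ _ xy) => -[].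
apply/val_inj/ffunP => -[k|y].
  have [l kl] := swapsl G1_struts k (gluing_swaps t).
  have [l' kl'] := swapsl G1_struts k (gluing_swaps t').
  by rewrite kl kl'; congr inr; apply: f2_inj; rewrite (U1 _ _ kl) (U1' _ _ kl').
have [yU|yT] := boolP (univalent G2 y); last first.
  by rewrite (matching_triv (gluing_matching t) yT) (matching_triv (gluing_matching t') yT).
have [k yk] := swapsr (gluing_swaps t) yU.
have [k' yk'] := swapsr (gluing_swaps t') yU.
rewrite yk yk'; congr inl; apply: f1_inj.
have /U1 E : val t (inl k) = inr y by rewrite -yk gluingK.
have /U1' : val t' (inl k') = inr y by rewrite -yk' gluingK.
by rewrite E => -[].
Qed.

Lemma gluing_of_cut b : b \in cut_isos -> exists2 a, a \in fibre & corresponds a b.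
Proof.
case: b => f1 f2 /finset.setXP[p1 p2].
have f2V y := isos_univalent y p2.
case/isosP: (p1) => /= f1_inj f1_surj f1v f1e f1c.
case/isosP: p2 => /= f2_inj f2_surj f2v f2e f2c.
have f2l y h : f2 y = inl h -> ~~ univalent G2 y.
  move=> yh; rewrite -f2V yh /univalent vtx_cutl (inj_eq (@inl_inj _ _)).
  exact: closed_trivalent.
have f2r y c : f2 y = inr c -> univalent G2 y.
  by move=> yc; rewrite -f2V yc /univalent vtx_cutr.
have /fin_all_exists[f fP] : forall x : T, exists h, exists2 y, val x = inr y & f2 y = inl h.
  move=> x; have [y xy yT] := triv_right x.
  case yh : (f2 y) => [h|c]; first by exists h, y.
  by move: yT; rewrite (f2r _ _ yh).
have fE x y : val x = inr y -> f2 y = inl (f x).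
  by move=> xy; have [y' xy' <-] := fP x; move: xy; rewrite xy' => -[->].
(* The graph of the gluing involution: a strut end and a leg are glued when their images are the
   same cut half-edge, and trivalent half-edges are fixed. *)
pose spec (z z' : H1 + H2) : Prop := match z, z' with
  | inl k, inr l | inr l, inl k => f2 l = inr (f1 k)
  | inr y, inr y' => y = y' /\ ~~ univalent G2 y
  | _, _ => False end.
have spec_sym z z' : spec z z' -> spec z' z.
  by case: z z' => [k|y] [k'|y'] //= [->].
have spec_inj z z' z'' : spec z z' -> spec z z'' -> z' = z''.
  case: z z' z'' => [k|y] [k'|y'] [k''|y''] //=.
  - by move=> E E'; congr inr; apply: f2_inj; rewrite E E'.
  - by move=> -> [/f1_inj->].
  - by move=> /f2r-> [].
  - by move=> [_ /negbTE yT] /f2r; rewrite yT.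
  - by move=> [<- _] [<- _].
have /fin_all_exists[tau0 tau0P] : forall z, exists z', spec z z'.
  case=> [k|y]; first by have [l lk] := f2_surj (inr (f1 k)); exists (inr l).
  case yh : (f2 y) => [h|c]; first by exists (inr y); split=> //; exact: f2l yh.
  by have [k kc] := f1_surj c; exists (inl k); rewrite /= yh kc.
pose tau := [ffun z => tau0 z].
have tauP z : spec z (tau z) by rewrite ffunE.
have tauE z z' : spec z z' -> tau z = z' by move=> zz'; exact: spec_inj (tauP z) zz'.
have tauM : is_matching U tau.
  apply/forallP => z; have zP := tauP z.
  have -> : tau (tau z) = z by apply/tauE/spec_sym.
  rewrite eqxx /=; case: z (tau z) zP => [k|y] [k'|y'] //=.
  - move=> kP; rewrite !unionE f1c f2c kP col_cutr col_struts eqxx /=.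
    by rewrite univalent_unionl.
  - move=> kP; rewrite !unionE f1c f2c kP col_cutr col_struts eqxx /=.
    by rewrite univalent_unionr (f2r _ _ kP).
  - by move=> [<- yT]; rewrite !eqxx univalent_unionr yT.
have tauS : swaps G1 G2 tau.
  apply/forallP => z; apply/implyP; have := tauP z.
  case: z (tau z) => [k|y] [k'|y'] //= [_ yT].
  by rewrite univalent_unionr (negbTE yT).
have tauG : is_gluing G1 G2 tau.
  by apply/and3P; split=> //; exact: struts_circle_free.
pose t : gluing G1 G2 := Sub tau tauG.
have f_val x x' : f x = f x' -> x = x'.
  move=> xx'; apply: val_inj; have [y xy yT] := triv_right x.
  have [y' xy' _] := triv_right x'; rewrite xy xy'; congr inr; apply: f2_inj.
  by rewrite (fE _ _ xy) (fE _ _ xy') xx'.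
exists (t, finfun f); last first.
  split=> /= [x y xy|k l kl]; first by rewrite ffunE; exact: fE.
  by have := tauP (inl k); rewrite kl.
rewrite finset.inE; apply/andP; split; last first.
  apply/forallP => x; have [y xy yT] := triv_right x.
  rewrite ffunE /cut_colour xy !unionE f2c f2e (fE _ _ xy).
  by case: edg_cutlP => [->|c <-]; rewrite ?col_cutl ?col_cutr.
rewrite finset.inE; apply/isosP; split=> /=.
- by move=> x x'; rewrite !ffunE; exact: f_val.
- move=> h; have [y yh] := f2_surj (inl h); have [x xy] := right_triv (f2l _ _ yh).
  by exists x; rewrite ffunE; move: (fE _ _ xy); rewrite yh => -[].
- move=> x; have [y xy yT] := triv_right x; rewrite !ffunE.
  have : f2 (vtx G2 y) = inl (vtx G (f x)) by rewrite f2v (fE _ _ xy) vtx_cutl.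
  by rewrite (fE (vtx (glued_graph (gluing_matching t)) x)) => [[]|] //;
    rewrite vtx_mkgraph /= xy unionE.
(* If the edge is cut, the walk crosses the strut at [k], and [val (f1 k)] is [f x]; the isomorphism
   [f1] then carries the far end of that strut to [edg G (f x)]. *)
- move=> x; have [y xy yT] := triv_right x; rewrite !ffunE edg_mkgraph.
  have eE := f2e y; rewrite (fE _ _ xy) in eE.
  case: (triv_edg_cases t xy) => [[eyT wE]|[k [l [eyU yk kl lU wE]]]].
    move: eE; rewrite (fE _ _ wE); by case: edg_cutlP => // _ [].
  have kP : f2 (edg G2 y) = inr (f1 k) by have := tauP (inr (edg G2 y)); rewrite yk.
  have lP : f2 l = inr (f1 (edg G1 k)) by have := tauP (inl (edg G1 k)); rewrite kl.
  have : f2 (edg G2 l) = inl (edg G (val (f1 k))).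
    by rewrite f2e lP edg_cutr f1e val_edg_struts.
  rewrite (fE _ _ wE) => -[->]; move: eE; rewrite kP.
  by case: edg_cutlP => // c <- [->].
- by move=> x; rewrite !col_None ?closed_trivalent.
Qed.

Lemma card_fibre : #|fibre| = (#|isos G1 (cut_struts s)| * #|isos G2 (cut_graph s)|)%N.
Proof.
rewrite -cardsX; apply: (card_correspondence (R := corresponds)).
- exact: cut_of_gluing.
- exact: gluing_of_cut.
- by move=> a b b' _; exact: corresponds_fun.
- by move=> a a' b _ _; exact: corresponds_inj.
Qed.

End Fibre.

Lemma card_glued_isos : #|glued_isos| =
  (\sum_(s : cutting G) #|isos G1 (cut_struts s)| * #|isos G2 (cut_graph s)|)%N.
Proof.
rewrite -sum1_card.
transitivity (\sum_(a in glued_isos) \sum_(s : cutting G) cuts_along s a.2)%N.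
  apply: eq_bigr => a /glued_isos_cutting[s sP].
  rewrite (bigD1 s) //= sP /= eqxx big1 // => s' /negbTE.
  by rewrite sP /= => ->.
rewrite exchange_big; apply: eq_bigr => s _; rewrite -card_fibre -[RHS]sum1_card.
rewrite big_mkcond [RHS]big_mkcond; apply: eq_bigr => a _.
by rewrite [in RHS]finset.in_set; case: (a \in glued_isos); case: (cuts_along s _).
Qed.

(** Both sides count pairs of a gluing and an isomorphism of its result onto [G]: a gluing of the
    right class has |Aut G| of these and any other has none. *)
Lemma card_gluings :
  (#|[set t : gluing G1 G2 | glue t == class_of G]%SET| * #|isos G G|)%N =
  (\sum_(s : cutting G) #|isos G1 (cut_struts s)| * #|isos G2 (cut_graph s)|)%N.
Proof.
rewrite -card_glued_isos -sum1_card big_distrl /=.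
transitivity (\sum_(t : gluing G1 G2)
    #|isos (glued_graph (gluing_matching t)) G|)%N.
  rewrite big_mkcond; apply: eq_bigr => t _; rewrite finset.in_set iso_class_of.
  case: ifP => [tG|/negbT tG]; last by rewrite card_isos0.
  by rewrite mul1n (card_isosl _ tG).
under eq_bigr do rewrite -sum1_card.
rewrite pair_big_dep -sum1_card; apply: eq_bigl => -[t f].
by rewrite [in RHS]finset.in_set.
Qed.

End GluingCuttings.

Theorem hat_pairing (Y H : finType) (D1 D2 : dalg Y) (G : utgraph void H) :
  (forall c, D1 c != 0 -> forall h, univalent (graph_of c) h) ->
  (forall c, D2 c != 0 -> ~~ has_strut (graph_of c)) ->
  hat (pairing D1 D2) G =
  \sum_(s : cutting G) hat D1 (cut_struts s) * hat D2 (cut_graph s).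
Proof.
move=> D1P D2P; rewrite hatE /pairing mulr_fsuml.
pose u (s : cutting (Y := Y) G) := (class_of (cut_struts s), class_of (cut_graph s)).
pose F (s : cutting G) (p : gclass Y * gclass Y) :=
  (D1 p.1 * #|isos (graph_of p.1) (cut_struts s)|%:R) *
  (D2 p.2 * #|isos (graph_of p.2) (cut_graph s)|%:R).
transitivity (\sum_(p \in [set: gclass Y * gclass Y]%classic) \sum_s F s p).
  apply: eq_fsbigr => p _.
  (* [card_gluings] applies only to a union of struts and a strutless graph, which is known on the
     supports; pairs with a zero coefficient are set aside. *)
  have [D10|D1N] := eqVneq (D1 p.1) 0.
    by rewrite D10 !mul0r big1 // => s _; rewrite /F D10 !mul0r.
  have [D20|D2N] := eqVneq (D2 p.2) 0.
    by rewrite D20 mulr0 !mul0r big1 // => s _; rewrite /F D20 mul0r mulr0.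
  rewrite -[LHS]mulrA -natrM card_gluings; [|exact: D1P|exact: D2P].
  by rewrite natr_sum mulr_sumr; apply: eq_bigr => s _; rewrite natrM mulrACA.
rewrite (fsbig_point (u := u)) // => [|s [c1 c2] _ pu].
  by apply: eq_bigr => s _; rewrite /F !hat_class.
rewrite /F /=; have [E1|/hat_class0->] := pselect (c1 = class_of (cut_struts s)).
  have [E2|/hat_class0->] := pselect (c2 = class_of (cut_graph s)).
    by case: pu; rewrite E1 E2.
  by rewrite !mulr0.
by rewrite mulr0 mul0r.
Qed.

(** * Cuttings of disjoint unions *)

Section CuttingUnion.
Context {Y H1 H2 : finType} (G1 : utgraph void H1) (G2 : utgraph void H2).
Local Notation U := (union_graph G1 G2).
Local Notation cutting G := (@cutting Y _ G).

Definition union_cutting_fun (s : cutting G1 * cutting G2) :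
    {ffun H1 + H2 -> option Y} :=
  [ffun h => match h with inl x => val s.1 x | inr x => val s.2 x end].

Lemma union_cutting_subproof s : is_cutting U (union_cutting_fun s).
Proof. by apply/forallP => -[x|x]; rewrite unionE !ffunE cutting_edg. Qed.

Definition union_cutting s : cutting U := Sub _ (union_cutting_subproof s).

Lemma union_cuttingl s x : val (union_cutting s) (inl x) = val s.1 x.
Proof. by rewrite SubK ffunE. Qed.

Lemma union_cuttingr s x : val (union_cutting s) (inr x) = val s.2 x.
Proof. by rewrite SubK ffunE. Qed.

Lemma union_cutting_bij : bijective union_cutting.
Proof.
have lP (s : cutting U) : is_cutting G1 [ffun x => val s (inl x)].
  by apply/forallP => x; rewrite !ffunE -(edg_unionl _ G2) cutting_edg.
have rP (s : cutting U) : is_cutting G2 [ffun x => val s (inr x)].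
  by apply/forallP => x; rewrite !ffunE -(edg_unionr G1) cutting_edg.
exists (fun s => (Sub _ (lP s), Sub _ (rP s))) => [[s1 s2]|s].
  by congr (_, _); apply/val_inj/ffunP => x; rewrite SubK ffunE SubK ffunE.
by apply/val_inj/ffunP => -[x|x]; rewrite SubK ffunE SubK ffunE.
Qed.

Lemma sum_union_cutting (F : cutting U -> rat) :
  \sum_s F s = \sum_s1 \sum_s2 F (union_cutting (s1, s2)).
Proof.
rewrite pair_big (reindex union_cutting) /=; last first.
  exact: onW_bij union_cutting_bij.
by apply: eq_bigr => -[].
Qed.

Section Iso.
Variables (s1 : cutting G1) (s2 : cutting G2).
Local Notation s := (union_cutting (s1, s2)).

Lemma union_cut_hedgel (x : cut_hedge s1) : val s (inl (val x)) != None.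
Proof. by rewrite union_cuttingl (valP x). Qed.

Lemma union_cut_hedger (x : cut_hedge s2) : val s (inr (val x)) != None.
Proof. by rewrite union_cuttingr (valP x). Qed.

Definition union_cut_hedge (z : cut_hedge s1 + cut_hedge s2) : cut_hedge s :=
  match z with
  | inl x => exist _ (inl (val x)) (union_cut_hedgel x)
  | inr x => exist _ (inr (val x)) (union_cut_hedger x)
  end.

Lemma union_cut_hedge_inj : injective union_cut_hedge.
Proof. by move=> [x|x] [y|y] /(congr1 val) //= [/val_inj ->]. Qed.

Lemma union_cut_hedge_surj x : exists z, union_cut_hedge z = x.
Proof.
case: x => -[x|x] xP.
  have xP' : val s1 x != None by move: (xP); rewrite union_cuttingl.
  by exists (inl (exist _ x xP')); apply: val_inj.
have xP' : val s2 x != None by move: (xP); rewrite union_cuttingr.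
by exists (inr (exist _ x xP')); apply: val_inj.
Qed.

Lemma iso_cut_struts_union :
  iso (union_graph (cut_struts s1) (cut_struts s2)) (cut_struts s).
Proof.
apply: (isoI (f := union_cut_hedge)).
- exact: union_cut_hedge_inj.
- exact: union_cut_hedge_surj.
- by case=> x; rewrite unionE !vtx_struts.
- by case=> x; apply: val_inj; rewrite unionE !val_edg_struts /= unionE val_edg_struts.
- by case=> x; rewrite unionE !col_struts /= ?union_cuttingl ?union_cuttingr.
Qed.

Definition union_cut_graph_map
    (z : (H1 + cut_hedge s1) + (H2 + cut_hedge s2)) : (H1 + H2) + cut_hedge s :=
  match z with
  | inl (inl h) => inl (inl h)
  | inl (inr x) => inr (union_cut_hedge (inl x))
  | inr (inl h) => inl (inr h)
  | inr (inr x) => inr (union_cut_hedge (inr x))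
  end.

Lemma iso_cut_graph_union :
  iso (union_graph (cut_graph s1) (cut_graph s2)) (cut_graph s).
Proof.
apply: (isoI (f := union_cut_graph_map)).
- move=> [[x|x]|[x|x]] [[y|y]|[y|y]] //= [] => [->|/val_inj->|->|/val_inj->] //.
- case=> [[h|h]|x]; [by exists (inl (inl h)) | by exists (inr (inl h)) |].
  by have [[z|z] <-] := union_cut_hedge_surj x; [exists (inl (inr z)) | exists (inr (inr z))].
- by move=> [[x|x]|[x|x]]; rewrite unionE ?vtx_cutl ?vtx_cutr //= unionE.
- move=> [[h|x]|[h|x]]; rewrite unionE ?edg_cutr //=.
  + case: (edg_cutlP s1 h) => [sh|x xh].
      by rewrite edg_cutl ?unionE // union_cuttingl.
    by rewrite -(edg_cutl_val (union_cut_hedge (inl x))) /= xh.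
  + case: (edg_cutlP s2 h) => [sh|x xh].
      by rewrite edg_cutl ?unionE // union_cuttingr.
    by rewrite -(edg_cutl_val (union_cut_hedge (inr x))) /= xh.
- by move=> [[x|x]|[x|x]]; rewrite unionE ?col_cutl ?col_cutr //= ?union_cuttingl ?union_cuttingr.
Qed.

End Iso.
End CuttingUnion.

(** * Supports of powers and exponentials *)

Lemma dscaleE (Y : finType) (x : rat) (D : dalg Y) c : (x *: D) c = x * D c.
Proof. by []. Qed.

Section Supports.
Context {Y : finType}.
Implicit Types D : dalg Y.

Lemma univalent_graph_of (H : finType) (G : utgraph Y H) :
  (forall h, univalent G h) -> forall h, univalent (graph_of (class_of G)) h.
Proof.
move=> GU h; have := iso_graph_of G; rewrite isosE => /existsP[f fP].
by rewrite -(isos_univalent _ fP).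
Qed.

Lemma strutless_graph_of (H : finType) (G : utgraph Y H) :
  ~~ has_strut G -> ~~ has_strut (graph_of (class_of G)).
Proof.
move=> GN; have := iso_graph_of G; rewrite isosE => /existsP[f fP].
apply: contra GN => /existsP[h]; rewrite -!(isos_univalent _ fP).
by case/isosP: fP => _ _ _ -> _ hP; apply/existsP; exists (f h).
Qed.

Lemma dmul_neq0 D1 D2 c : dmul D1 D2 c != 0 ->
  exists c1 c2, [/\ cunion c1 c2 = c, D1 c1 != 0 & D2 c2 != 0].
Proof.
(* The dummy argument gives the summand the parametrised shape that [fsbigN1] expects. *)
pose F (_ : unit) (p : gclass Y * gclass Y) := D1 p.1 * D2 p.2.
move=> /(@fsbigN1 _ _ _ _ _ _ F tt)[[c1 c2] /= cE].
by rewrite /F mulf_eq0 negb_or => /andP[]; exists c1, c2.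
Qed.

Lemma dsum_neq0 (F : nat -> dalg Y) c : dsum F c != 0 -> exists p, F p c != 0.
Proof. by move=> /(@fsbigN1 _ _ _ _ _ _ (fun c p => F p c) c)[p]; exists p. Qed.

Section Closed.
Variables (D : dalg Y) (P : gclass Y -> Prop).
Hypothesis P0 : P (class_of (@empty_graph Y)).
Hypothesis PU : forall c1 c2, P c1 -> P c2 -> P (cunion c1 c2).
Hypothesis DP : forall c, D c != 0 -> P c.

Lemma dpow_support p c : dpow D p c != 0 -> P c.
Proof.
elim: p c => [|p IHp] c /=.
  by rewrite /basis; have [-> //|_] := eqVneq c (class_of _); rewrite eqxx.
by case/dmul_neq0 => c1 [c2 [<- /DP ? /IHp ?]]; apply: PU.
Qed.

Lemma dexp_support c : dexp D c != 0 -> P c.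
Proof.
case/dsum_neq0 => p cN; apply: (@dpow_support p); apply: contraNneq cN => D0.
by rewrite dscaleE D0 mulr0.
Qed.

End Closed.

Lemma strutless_dpow D p c : substantial D ->
  dpow D p c != 0 -> ~~ has_strut (graph_of c).
Proof.
move=> DS; apply: (dpow_support (P := fun c => ~~ has_strut (graph_of c))) => //.
- by apply: strutless_graph_of; apply/existsPn => -[].
- move=> c1 c2 /existsPn N1 /existsPn N2; apply: strutless_graph_of.
  apply/existsPn => -[h|h]; rewrite /univalent !unionE.
    by rewrite !(inj_eq (@inl_inj _ _)); exact: N1.
  by rewrite !(inj_eq (@inr_inj _ _)); exact: N2.
Qed.

Lemma strutless_dexp D c : substantial D ->
  dexp D c != 0 -> ~~ has_strut (graph_of c).
Proof.
move=> DS /dsum_neq0[p cN]; apply: (@strutless_dpow D p) => //.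
by apply: contraNneq cN => D0; rewrite dscaleE D0 mulr0.
Qed.

Lemma univalent_dexp D : (forall c, D c != 0 -> forall h, univalent (graph_of c) h) ->
  forall c, dexp D c != 0 -> forall h, univalent (graph_of c) h.
Proof.
move=> DU; apply: dexp_support => //; first by apply: univalent_graph_of; case.
move=> c1 c2 U1 U2; apply: univalent_graph_of => -[h|h]; rewrite /univalent unionE.
  by rewrite (inj_eq (@inl_inj _ _)); exact: U1.
by rewrite (inj_eq (@inr_inj _ _)); exact: U2.
Qed.

End Supports.

(** A cutting of a disjoint union is a pair of cuttings, and both its struts and its cut graph are
    disjoint unions accordingly, so the sum in [hat_pairing] factors. *)
Lemma pairing_grouplike (Y : finType) (D1 D2 : dalg Y) :
  (forall c, D1 c != 0 -> forall h, univalent (graph_of c) h) ->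
  (forall c, D2 c != 0 -> ~~ has_strut (graph_of c)) ->
  grouplike D1 -> grouplike D2 -> grouplike (pairing D1 D2).
Proof.
move=> D1U D2N [D1e D1M] [D2e D2M]; split; last first.
  move=> H1 H2 G1 G2; rewrite !hat_pairing // sum_union_cutting mulr_suml.
  apply: eq_bigr => s1 _; rewrite mulr_sumr; apply: eq_bigr => s2 _.
  rewrite -(hat_iso _ (iso_cut_struts_union s1 s2)) D1M.
  by rewrite -(hat_iso _ (iso_cut_graph_union s1 s2)) D2M mulrACA.
rewrite hat_pairing //.
(* The empty graph has a single cutting, both of whose pieces are empty. *)
have s0P : is_cutting (@empty_graph void) [ffun=> @None Y] by apply/forallP => -[].
rewrite (bigD1 (Sub _ s0P)) //= big1 => [|s /eqP[]]; last first.
  by apply/val_inj/ffunP => -[].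
have cut0 : #|cut_hedge (Sub _ s0P : cutting (@empty_graph void))| = 0%N.
  by apply/eqP; rewrite -leqn0 card_sig; apply: leq_trans (max_card _) _; rewrite card_void.
rewrite (hat_iso D1 (iso_empty _ cut0)) D1e.
by rewrite (hat_iso D2 (iso_empty _ _)) ?card_sum ?card_void ?cut0 // D2e mulr1 addr0.
Qed.

(** * Sums of struts and the theorem *)

Section StrutSums.
Variables (n : nat) (a : 'I_n -> 'I_n -> rat).

Definition strut_sum : dalg 'I_n :=
  \sum_(i < n) \sum_(j < n | (i <= j)%N) a i j *: strut i j.

Lemma strut_sum_neq0 c : strut_sum c != 0 ->
  exists i j, c = class_of (strut_graph i j).
Proof.
have sumE (I : Type) (r : seq I) (P : pred I) (F : I -> dalg 'I_n) :
    (\sum_(i <- r | P i) F i) c = \sum_(i <- r | P i) F i c.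
  exact: (big_morph (fun D : dalg 'I_n => D c)).
apply: contraNP => cN; rewrite /strut_sum sumE big1 // => i _; rewrite sumE big1 // => j _.
rewrite dscaleE /strut /basis; case: eqP => [cE|_]; last by rewrite mulr0.
by case: cN; exists i, j.
Qed.

Lemma strut_sum_connected : connected strut_sum.
Proof.
move=> c /strut_sum_neq0[i [j ->]]; rewrite connected_graph_of.
rewrite /connected_graph card_bool /=; apply/forallP => h; apply/forallP => k.
have [->|hk] := eqVneq h k; first exact: connect0.
by apply: connect1; rewrite /adj /= edg_mkgraph; case: h k hk => [] [] //; rewrite !orbT.
Qed.

Lemma strut_sum_univalent c : strut_sum c != 0 -> forall h, univalent (graph_of c) h.
Proof.
move=> /strut_sum_neq0[i [j ->]]; apply: univalent_graph_of => h.
by rewrite /univalent vtx_mkgraph.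
Qed.

End StrutSums.

Section ConnectedPart.
Context {Y : finType} (E C : dalg Y).
Hypothesis E_univalent : forall c, E c != 0 -> forall h, univalent (graph_of c) h.
Hypothesis C_substantial : substantial C.
Hypothesis C_connected : connected C.

(** The exponent of the theorem; the shift to [p.+1] makes the sum start at 1. *)
Definition free_energy : dalg void :=
  dsum (fun p => (p.+1`!%:R)^-1 *: cpairing E (dpow C p.+1)).

Lemma free_energy_connected : connected free_energy.
Proof.
move=> c /dsum_neq0[p]; rewrite dscaleE /cpairing /connected_part.
by case: ifP => //; rewrite mulr0 eqxx.
Qed.

Lemma hat_pairing_expterm p (H : finType) (G : utgraph void H) :
  (p`!%:R)^-1 * hat (pairing E (dpow C p)) G =
  \sum_(s : cutting G) hat E (cut_struts s) * hat (expterm C p) (cut_graph s).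
Proof.
rewrite hat_pairing // => [|c]; last exact: strutless_dpow.
by rewrite mulr_sumr; apply: eq_bigr => s _; rewrite hatZ mulrCA.
Qed.

Lemma pairing_dexp_connected c : connected_graph (graph_of c) ->
  pairing E (dexp C) c = free_energy c.
Proof.
(* A cut graph has at most one new end per half-edge of [G], hence at most [N] half-edges, so C^p
   vanishes on it for p > [N]. This one bound truncates both series for all cuttings. *)
move=> cc; set G := graph_of c; pose N := (#|hedges c| + #|hedges c|)%N.
have H0 : (0 < #|hedges c|)%N by case/andP: cc.
suff : hat (pairing E (dexp C)) G = hat free_energy G.
  rewrite !hatE graph_ofK; apply: mulIf.
  by rewrite pnatr_eq0 -lt0n card_auts_gt0.
have cutN (s : cutting (Y := Y) G) : (#|{: hedges c + cut_hedge s}| < N.+1)%N.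
  by rewrite ltnS card_sum leq_add2l card_sig; exact: max_card.
have termE p : hat ((p.+1`!%:R)^-1 *: cpairing E (dpow C p.+1)) G =
    \sum_(s : cutting G) hat E (cut_struts s) * hat (expterm C p.+1) (cut_graph s).
  by rewrite hatZ -hat_pairing_expterm hatE /cpairing /connected_part
    connected_graph_of cc -hatE.
rewrite /free_energy (@hat_dsum_trunc _ _ N) => [|p Np]; last first.
  rewrite termE big1 // => s _; rewrite hat_expterm_eq0 ?mulr0 //.
  exact: leq_trans (cutN s) _.
rewrite hat_pairing // => [|c']; last exact: strutless_dexp.
under [RHS]eq_bigr do rewrite termE.
rewrite exchange_big; apply: eq_bigr => s _ /=.
(* The term p = 0 sees only the empty graph, while a cut graph keeps all half-edges of the nonempty
   [G]; the terms 1 to [N] are left, as on the other side. *)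
rewrite (hat_dexp _ C_connected (cutN s)) big_ord_recl hat_expterm0.
by rewrite card_sum addn_eq0 (gtn_eqF H0) add0r mulr_sumr.
Qed.

End ConnectedPart.

Theorem theorem2p2 (n : nat) (C : dalg 'I_n) (a : 'I_n -> 'I_n -> rat)
    (C_substantial : substantial C) (C_connected : connected C) :
  let E := dexp (\sum_(i < n) \sum_(j < n | (i <= j)%N) a i j *: strut i j) in
  pairing E (dexp C) =
  dexp (dsum (fun p => (p.+1`!%:R)^-1 *: cpairing E (dpow C p.+1))).
Proof.
move=> E.
have EU : forall c, E c != 0 -> forall h, univalent (graph_of c) h.
  exact/univalent_dexp/strut_sum_univalent.
have Kc : connected (free_energy E C) by exact: free_energy_connected.
apply: grouplike_ext.
- apply: pairing_grouplike => //; first by move=> c; exact: strutless_dexp.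
    exact/dexp_grouplike/strut_sum_connected.
  exact: dexp_grouplike.
- exact: dexp_grouplike.
- move=> c cc; rewrite dexp_connected //; exact: pairing_dexp_connected.
Qed.
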